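(* Let $E$ be a separable real Hilbert space and let $p\geq4$ be an even integer. If $\Phi\colon\mathcal{W}_p(E)\to\mathcal{W}_p(E)$ is an isometry (distance preserving bijection), then there exists an (affine) isometry $\psi\colon E\to E$ such that $\Phi(\mu)=\psi_\#\mu$ for all $\mu\in\mathcal{W}_p(E)$.
   Context: $\mathcal{W}_p(E)$ is the set of Borel probability measures $\mu$ on $E$ with $\int_E\|x\|^p\,d\mu(x)<\infty$, equipped with $d_{\mathcal{W}_p}(\mu,\nu)=\big(\inf_{\pi\in\Pi(\mu,\nu)}\int_{E\times E}\|x-y\|^p\,d\pi(x,y)\big)^{1/p}$, where $\Pi(\mu,\nu)$ is the set of Borel probability measures on $E\times E$ with marginals $\mu$ and $\nu$. The push-forward is $(g_\#\mu)(A)=\mu(g^{-1}[A])$. *)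

(* Defs.v *)
From HB Require Import structures.
From mathcomp Require Import all_boot all_order all_algebra.
From mathcomp Require Import all_classical all_reals all_analysis.
Set Implicit Arguments. Unset Strict Implicit. Unset Printing Implicit Defensive.
Import Order.TTheory GRing.Theory Num.Theory.
Import numFieldNormedType.Exports.
Local Open Scope classical_set_scope.
Local Open Scope ring_scope.

Section Wasserstein.
Context {R : realType} {E : normedModType R}.

Record inner_product (ip : E -> E -> R) : Prop := {
  ip_sym : forall x y, ip x y = ip y x ;
  ip_linearl : forall (a : R) x y z, ip (a *: x + y) z = a * ip x z + ip y z ;
  ip_norm : forall x, ip x x = `|x| ^+ 2 }.

Definition separable : Prop := exists D : set E, countable D /\ dense D.

Definition borelE := g_sigma_algebraType (@open E).

Definition finite_moment (p : nat) (mu : probability borelE R) : Prop :=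
  (\int[mu]_x ((`|(x : E)| ^+ p)%:E) < +oo)%E.

Definition Wp (p : nat) := {mu : probability borelE R | finite_moment p mu}.

Definition coupling (mu nu : probability borelE R)
  (pi : probability (borelE * borelE)%type R) : Prop :=
  forall A : set borelE, measurable A ->
    pi (A `*` setT) = mu A /\ pi (setT `*` A) = nu A.

Definition wcost (p : nat) (mu nu : probability borelE R) : \bar R :=
  ereal_inf [set c | exists pi, coupling mu nu pi /\
     c = (\int[pi]_z ((`|(z.1 : E) - (z.2 : E)| ^+ p)%:E))%E].

(* Wasserstein distance (the infimum is finite on W_p(E)). *)
Definition wdist (p : nat) (mu nu : probability borelE R) : R :=
  powR (fine (wcost p mu nu)) (p%:R)^-1.

End Wasserstein.

(* Main.v *)
(* Dirac masses are exactly the [mu] such that every segment from [mu] to some [nu] can be doubled beyond [nu]; this is a metric property, so [Phi] maps [\d_x] to [\d_(psi x)] for an isometry [psi] of [E], and after composing with its inverse we may assume that [Phi] fixes all Dirac masses. Then [Phi] preserves the potentials [a |-> \int |a - y|^p dmu]. For even [p] these are polynomial in [a]; extracting one coefficient yields the second moments of [mu] (here [p >= 4] enters) and, with the equality cases of Cauchy-Schwarz and Jensen, shows that every measure carried by two points is fixed. The costs from [mu] to all two-point measures determine, by Legendre duality, the masses of all half-spaces, hence of all hyperplanes, which identifies finitely supported [mu]. Finitely supported measures are dense and [Phi] is an isometry, so [Phi] is the identity. *)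

(* Why Dirac masses are not enough as test measures: for even [p] a potential is a polynomial, so it
   records only moments up to order [p] and in general does not determine the measure. Measures on
   two points are the next simplest family, and they are extremal enough for their potentials to
   identify them. Write [p = 2k], put the origin at the midpoint [m] of the two points, and let [x]
   be a unit vector. The extracted coefficient is [k |y|^2 + 2k(k-1) <x,y>^2]. For [p = 2] the
   directional term vanishes and only the total variance is seen. For [p >= 4] its weight is
   positive, and comparing the direction of the segment with an orthogonal one forces the image
   measure onto the line through the two points; the moment of order [p] then fixes the distance to
   [m]. Distances enter only through their [p]-th powers [wcost], so no root and no triangle
   inequality for the transport distance is ever used. *)
Require Import Defs.
From HB Require Import structures.
From mathcomp Require Import all_boot all_order all_algebra.
From mathcomp Require Import all_classical all_reals all_analysis.
From mathcomp Require Import measurable_realfun ring lra.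
Set Implicit Arguments. Unset Strict Implicit. Unset Printing Implicit Defensive.
Import Order.TTheory GRing.Theory Num.Theory.
Import numFieldNormedType.Exports.
Local Open Scope classical_set_scope.
Local Open Scope ring_scope.

(** * Push-forward of a probability measure and change of variables *)

Section push.
Context d1 d2 (T1 : measurableType d1) (T2 : measurableType d2) (R : realType).
Variables (P : probability T1 R) (f : T1 -> T2).
Hypothesis mf : measurable_fun setT f.

Definition push : probability T2 R :=
  let X : {mfun T1 >-> T2} := HB.pack f (isMeasurableFun.Build _ _ _ _ f mf) in
  distribution P X.

Lemma pushE A : push A = P (f @^-1` A). Proof. by []. Qed.

Lemma integral_push (g : T2 -> \bar R) : measurable_fun setT g ->
  (forall y, 0 <= g y)%E -> (\int[push]_y g y = \int[P]_x g (f x))%E.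
Proof.
move=> mg g0.
by have /= := ge0_integral_pushforward mf P measurableT mg (fun y _ => g0 y).
Qed.
End push.

(** * Borel measurability in a separable normed space *)

Section borel.
Context {R : realType} {E : normedModType R}.
Local Notation B := (@borelE R E).

Lemma borel_open (A : set E) : open A -> measurable (A : set B).
Proof. exact: sub_sigma_algebra. Qed.

Lemma borel_closed (A : set E) : closed A -> measurable (A : set B).
Proof.
move=> cA; rewrite -[A]setCK; apply: measurableC; apply: borel_open.
exact: closed_openC.
Qed.

Lemma borel_set1 (a : E) : measurable ([set a] : set B).
Proof.
by apply: borel_closed; apply: accessible_closed_set1; apply: hausdorff_accessible.
Qed.

Lemma borel_fun_real (f : E -> R) : continuous f ->
  measurable_fun setT (f : B -> R).
Proof.
move=> cf; apply: (measurability _ (RGenOInfty.measurableE R)).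
move=> _ [_ [a ->] <-]; rewrite setTI; apply: borel_open.
by apply: open_comp => // x _; exact: cf.
Qed.

Lemma borel_fun (f : E -> E) : continuous f -> measurable_fun setT (f : B -> B).
Proof.
move=> cf; apply: (measurability _ (erefl : @measurable _ B = <<s open >>)).
move=> _ [A oA <-]; rewrite setTI; apply: borel_open.
by apply: open_comp => // x _; exact: cf.
Qed.

Lemma borel_dist (a : E) : measurable_fun setT ((fun x => `|x - a|) : B -> R).
Proof.
apply: borel_fun_real => x; apply: cvg_norm; apply: cvgB => //; exact: cvg_cst.
Qed.

Lemma borel_dist' (a : E) : measurable_fun setT ((fun x => `|a - x|) : B -> R).
Proof. by under eq_fun do rewrite distrC; exact: borel_dist. Qed.

Lemma dense_sequence : @separable R E ->
  exists s : nat -> E, forall x (e : R), 0 < e -> exists n, `|x - s n| < e.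
Proof.
move=> [D [cD dD]].
have [x0 Dx0] : D !=set0.
  have [|x [_ Dx]] := dD setT _ openT; last by exists x.
  by exists 0.
have /pfcard_geP[D0|[f]] : (D #<= [set: nat])%card by [].
  by move: Dx0; rewrite D0.
exists f => x e e0.
have [|y [xy Dy]] := dD (ball x e) _ (ball_open x e).
  by exists x; exact: ballxx.
have [n _ fn] := @surj _ _ _ _ f y Dy.
by exists n; rewrite fn; move: xy; rewrite -ball_normE.
Qed.

(* [|y - z| = inf_n (|y - s n| + |s n - z|)] for a dense sequence [s]; without separability the product of the Borel algebras may be too small. *)
Lemma measurable_dist : @separable R E ->
  measurable_fun setT ((fun z => `|(z.1 : E) - (z.2 : E)|) : B * B -> R).
Proof.
move=> /dense_sequence[s hs].
apply: (measurability _ (RGenInftyO.measurableE R)).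
move=> _ [_ [r ->] <-]; rewrite setTI.
rewrite (_ : _ @^-1` _ = \bigcup_n
    [set z : B * B | `|(z.1 : E) - s n| + `|(z.2 : E) - s n| < r]).
  apply: bigcupT_measurable => n.
  rewrite -[X in measurable X]setTI; apply: (measurable_fun_ltr _ _ measurableT (Y := [set true])) => //.
  apply: measurable_funD.
    exact: (measurableT_comp (borel_dist _) measurable_fst).
  exact: (measurableT_comp (borel_dist _) measurable_snd).
apply/seteqP; split => [z /=|z [n _]/=]; rewrite in_itv/=.
  move=> zr; have [|n hn] := hs z.2 ((r - `|(z.1:E) - (z.2:E)|) / 2).
    by rewrite divr_gt0// subr_gt0.
  exists n => //=.
  have := ler_distD (z.2 : E) (z.1 : E) (s n); lra.
move=> zr; apply: le_lt_trans zr.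
by rewrite (distrC (z.2 : E)) ler_distD.
Qed.
End borel.

(** * Sets of full measure and almost sure statements *)

Section full_sets.
Context d (T : measurableType d) (R : realType) (P : probability T R).
Local Open Scope ereal_scope.

Lemma full_setC A : measurable A -> P A = 1 -> P (~` A) = 0.
Proof. by move=> mA PA; rewrite probability_setC// PA subee. Qed.

Lemma full_setI A B : measurable A -> measurable B -> P A = 1 ->
  P B = P (A `&` B).
Proof.
move=> mA mB PA; rewrite -[B in LHS]setTI -(setUCr A) setIUl measureU//.
- rewrite [X in _ + X](_ : _ = 0) ?adde0//.
  apply: (subset_measure0 _ _ (@subIsetl _ (~` A) B)) => //.
  - by apply: measurableI => //; exact: measurableC.
  - exact: measurableC.
  - exact: full_setC.
- exact: measurableI.
- by apply: measurableI => //; exact: measurableC.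
- by rewrite setIACA setICr set0I.
Qed.

Lemma full_ae A (Q : T -> Prop) : measurable A -> P A = 1 ->
  (forall x, A x -> Q x) -> {ae P, forall x, Q x}.
Proof.
move=> mA PA AQ; exists (~` A); split; first exact: measurableC.
  exact: full_setC.
by move=> x/= nQ /AQ.
Qed.

Lemma ae_full A : measurable A -> {ae P, forall x, A x} -> P A = 1.
Proof.
move=> mA aeA; have PA : P (~` A) = 0.
  by apply: measure_negligible => //; exact: measurableC.
rewrite -(probability_setT P) -(setUCr A) measureU ?setICr//.
  by rewrite -[LHS]adde0; congr (_ + _); exact/esym/PA.
exact: measurableC.
Qed.

Lemma ae_exists (Q : T -> Prop) : {ae P, forall x, Q x} -> exists x, Q x.
Proof.
move=> [N [mN PN QN]]; apply: contrapT => /forallNP nQ.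
have : P N = 1.
  rewrite -(probability_setT P); congr (P _); apply/seteqP; split => // x _.
  exact/QN/nQ.
by rewrite PN => /eqP; rewrite eqe eq_sym oner_eq0.
Qed.

Lemma full_sub A B : measurable A -> measurable B -> A `<=` B -> P A = 1 ->
  P B = 1.
Proof. by move=> mA mB AB PA; rewrite (full_setI mA mB PA) (setIidl AB). Qed.

Lemma integral_eq0_ae (f : T -> \bar R) : measurable_fun setT f ->
  (forall x, 0 <= f x) -> \int[P]_x f x = 0 -> {ae P, forall x, f x = 0}.
Proof.
move=> mf f0 if0.
have : ae_eq P setT f (cst 0).
  apply/(ae_eq_integral_abs _ _ _).1 => //.
  by under eq_integral do rewrite gee0_abs//.
by apply: filterS => x /(_ I).
Qed.

Lemma eq_integral_full A (f g : T -> \bar R) : measurable A -> P A = 1 ->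
  measurable_fun setT f -> measurable_fun setT g ->
  (forall x, A x -> f x = g x) -> \int[P]_x f x = \int[P]_x g x.
Proof.
move=> mA PA mf mg fg; apply: ae_eq_integral => //.
by apply: (full_ae mA PA) => x Ax _; exact: fg.
Qed.

Lemma integral_cst1 (c : \bar R) : \int[P]_x c = c.
Proof.
have := integral_cst P (@measurableT _ T) c.
by rewrite [X in c * X](probability_setT P) mule1.
Qed.

End full_sets.

Lemma exprD_le (R : realFieldType) (a b : R) n : 0 <= a -> 0 <= b ->
  (a + b) ^+ n.+1 <= 2 ^+ n * (a ^+ n.+1 + b ^+ n.+1).
Proof.
move=> a0 b0; elim: n => [|n ih]; first by rewrite expr0 mul1r !expr1.
rewrite exprS (le_trans (ler_wpM2l _ ih)) ?addr_ge0//.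
rewrite [a ^+ n.+2]exprS [b ^+ n.+2]exprS [2 ^+ n.+1]exprS mulrCA.
rewrite [2 * _]mulrC -mulrA ler_wpM2l ?exprn_ge0//.
set S := a ^+ _; set T := b ^+ _.
(* Chebyshev's inequality: [a, b] and their powers are ordered alike, so
   [(a + b)(S + T) <= 2(aS + bT)]. *)
have : 0 <= (a - b) * (S - T).
  have [ab|/ltW ab] := leP a b.
    by rewrite mulr_le0// subr_le0// lerXn2r.
  by rewrite mulr_ge0// subr_ge0// lerXn2r.
lra.
Qed.

(** * Inner product calculus and the equality case of the convexity bound *)

Section inner_product_theory.
Context {R : realType} {E : normedModType R} (ip : E -> E -> R).
Hypothesis hip : inner_product ip.
Implicit Types x y z u v : E.

Lemma ipC x y : ip x y = ip y x. Proof. exact: ip_sym. Qed.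

Lemma ipxx x : ip x x = `|x| ^+ 2. Proof. exact: ip_norm. Qed.

Lemma ipDl x y z : ip (x + y) z = ip x z + ip y z.
Proof. by rewrite -[x]scale1r (ip_linearl hip) mul1r scale1r. Qed.

Lemma ip0l x : ip 0 x = 0.
Proof. by apply: (@addrI _ (ip 0 x)); rewrite -ipDl !addr0. Qed.

Lemma ipZl a x y : ip (a *: x) y = a * ip x y.
Proof. by rewrite -[a *: x]addr0 (ip_linearl hip) ip0l addr0. Qed.

Lemma ipNl x y : ip (- x) y = - ip x y.
Proof. by rewrite -scaleN1r ipZl mulN1r. Qed.

Lemma ipBl x y z : ip (x - y) z = ip x z - ip y z.
Proof. by rewrite ipDl ipNl. Qed.

Lemma ipDr x y z : ip x (y + z) = ip x y + ip x z.
Proof. by rewrite ipC ipDl !(ipC x). Qed.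

Lemma ipZr a x y : ip x (a *: y) = a * ip x y.
Proof. by rewrite ipC ipZl (ipC x). Qed.

Lemma ipNr x y : ip x (- y) = - ip x y.
Proof. by rewrite ipC ipNl (ipC x). Qed.

Lemma ipBr x y z : ip x (y - z) = ip x y - ip x z.
Proof. by rewrite ipDr ipNr. Qed.

Definition ipE := (ipDl, ipDr, ipNl, ipNr, ipZl, ipZr).

Lemma normD2 x y : `|x + y| ^+ 2 = `|x| ^+ 2 + 2 * ip x y + `|y| ^+ 2.
Proof. rewrite -!ipxx !ipE (ipC y x); ring. Qed.

Lemma normB2 x y : `|x - y| ^+ 2 = `|x| ^+ 2 - 2 * ip x y + `|y| ^+ 2.
Proof. by rewrite normD2 normrN ipNr; ring. Qed.

(** Polarization reduces the claim to continuity of the norm, with no appeal to Cauchy-Schwarz. *)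
Lemma ip_continuous u : continuous (ip u).
Proof.
have -> : ip u = fun y => (`|u + y| ^+ 2 - `|u| ^+ 2 - `|y| ^+ 2) / 2.
  by apply/funext => y; rewrite normD2; field.
move=> y; apply: cvgM; last exact: cvg_cst.
by apply: cvgB; [apply: cvgB; last exact: cvg_cst|];
  rewrite ?expr2; (apply: cvgM; apply: cvg_norm => //; apply: cvgD => //; exact: cvg_cst).
Qed.

Lemma ip_measurable u : measurable_fun setT (ip u : @borelE R E -> R).
Proof. by apply: borel_fun_real; exact: ip_continuous. Qed.

(** Pythagoras; it serves as Cauchy-Schwarz together with its equality case, since the left side is
    nonnegative and vanishes only on the line of [e]. *)
Lemma ip_unit e y : `|e| = 1 ->
  `|y - ip e y *: e| ^+ 2 = `|y| ^+ 2 - ip e y ^+ 2.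
Proof. by move=> e1; rewrite normB2 ipZr normrZ e1 mulr1 -normrX ger0_norm ?sqr_ge0// (ipC y); ring. Qed.

(** By the parallelogram law [|x - y|^2] falls short of [2(|x|^2 + |y|^2)] by exactly [|x + y|^2].
    If [x + y] were nonzero, the gap would survive the power [k+1] and contradict [exprD_le]. *)
Lemma norm_sub_expr_eq k x y :
  2 ^+ (k.+1.*2).-1 * (`|x| ^+ k.+1.*2 + `|y| ^+ k.+1.*2) = `|x - y| ^+ k.+1.*2 ->
  x = - y.
Proof.
rewrite -!mul2n !exprM.
have -> : (2 * k.+1).-1 = (k.+1 + k)%N by rewrite mul2n -addnn addSn addnS.
set A := `|x| ^+ 2; set B := `|y| ^+ 2; set D := `|x - y| ^+ 2.
have AB0 : 0 <= A /\ 0 <= B by rewrite !exprn_ge0.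
move=> h; apply/eqP; rewrite -subr_eq0 opprK -normr_eq0 -sqrf_eq0.
rewrite eq_le exprn_ge0// andbT leNgt; apply/negP => N0.
have DAB : D < 2 * (A + B).
  by move: N0; rewrite /D normB2 normD2 -/A -/B; lra.
have D0 : 0 <= D by rewrite exprn_ge0.
clearbody A B D.
have : D ^+ k.+1 < (2 * (A + B)) ^+ k.+1.
  by rewrite ltrXn2r ?nnegrE// mulr_ge0 ?addr_ge0//; case: AB0.
rewrite -h exprMn exprD -mulrA ltr_pM2l ?exprn_gt0// ltNge.
by rewrite exprD_le//; case: AB0.
Qed.

End inner_product_theory.

(** * Couplings, transport costs, and the metric characterization of Dirac masses *)

Section couplings.
Context {R : realType} {E : normedModType R}.
Local Notation B := (@borelE R E).
Hypothesis hsep : @separable R E.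
Variable p : nat.
Implicit Types mu nu : probability B R.
Local Open Scope ereal_scope.

(** Equality of the records would also compare the meaningless values on non-measurable sets. *)
Definition weq (mu nu : probability B R) :=
  forall A : set B, measurable A -> mu A = nu A.

(** The potential of [mu] at [a]. By [wcost_dirac] it is a transport cost, hence a metric
    quantity. *)
Definition moment (mu : probability B R) (a : E) : \bar R :=
  \int[mu]_y ((`|a - (y : E)| ^+ p)%R)%:E.

Lemma measurable_cost :
  measurable_fun setT ((fun z => (`|(z.1 : E) - (z.2 : E)| ^+ p)%:E) : B * B -> \bar R).
Proof. by apply/measurable_EFinP/measurable_funX; exact: measurable_dist. Qed.

Lemma measurable_moment (a : E) :
  measurable_fun setT ((fun y => (`|a - (y : E)| ^+ p)%:E) : B -> \bar R).
Proof. by apply/measurable_EFinP/measurable_funX; exact: borel_dist'. Qed.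

Lemma cost_ge0 (x : E) : 0 <= (`|x| ^+ p)%:E.
Proof. by rewrite lee_fin exprn_ge0. Qed.
Hint Resolve cost_ge0 : core.

Lemma coupling_push d (T : measurableType d) (P : probability T R) (f g : T -> B)
  (mf : measurable_fun setT f) (mg : measurable_fun setT g) mu nu :
  weq mu (push P mf) -> weq nu (push P mg) ->
  coupling mu nu (push P (measurable_fun_pair mf mg)).
Proof.
move=> hmu hnu A mA; rewrite (hmu A mA) (hnu A mA); split.
  rewrite (pushE P mf) (pushE P (measurable_fun_pair mf mg)).
  by congr (P _); apply/seteqP; split => x //= -[].
rewrite (pushE P mg) (pushE P (measurable_fun_pair mf mg)).
by congr (P _); apply/seteqP; split => x //= -[].
Qed.

(** The source of upper bounds on costs: a transport plan is given by two maps on a common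
    probability space. The marginals are required only up to [weq], so [mu] itself may appear
    through the identity map or a projection. *)
Lemma wcost_le_push d (T : measurableType d) (P : probability T R) (f g : T -> B)
  (mf : measurable_fun setT f) (mg : measurable_fun setT g) mu nu :
  weq mu (push P mf) -> weq nu (push P mg) ->
  wcost p mu nu <= \int[P]_t (`|(f t : E) - (g t : E)| ^+ p)%:E.
Proof.
move=> hmu hnu; apply: ereal_inf_lbound.
exists (push P (measurable_fun_pair mf mg)); split; first exact: coupling_push.
rewrite (integral_push P (measurable_fun_pair mf mg) measurable_cost)//.
Qed.

Lemma wcost_ge (c : \bar R) mu nu :
  (forall pi, coupling mu nu pi ->
    c <= \int[pi]_z (`|(z.1 : E) - (z.2 : E)| ^+ p)%:E) ->
  c <= wcost p mu nu.
Proof. by move=> h; apply: le_ereal_inf_tmp => _ [pi [hpi ->]]; exact: h. Qed.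

Lemma wcost_ge0 mu nu : 0 <= wcost p mu nu.
Proof. by apply: wcost_ge => pi _; exact: integral_ge0. Qed.

Lemma coupling_fst mu nu pi : coupling mu nu pi -> weq mu (push pi measurable_fst).
Proof.
move=> hpi A mA; rewrite -(hpi A mA).1 (pushE pi measurable_fst).
by congr (pi _); apply/seteqP; split => z //= -[].
Qed.

Lemma coupling_snd mu nu pi : coupling mu nu pi -> weq nu (push pi measurable_snd).
Proof.
move=> hpi A mA; rewrite -(hpi A mA).2 (pushE pi measurable_snd).
by congr (pi _); apply/seteqP; split => z //= -[].
Qed.

Lemma weq_integral mu nu (h : B -> \bar R) : weq mu nu ->
  \int[mu]_y h y = \int[nu]_y h y.
Proof. by move=> hw; apply: eq_measure_integral => A mA _; exact: hw. Qed.

Lemma coupling_integral1 mu nu pi (h : B -> \bar R) : coupling mu nu pi ->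
  measurable_fun setT h -> (forall y, 0 <= h y) ->
  \int[pi]_z h z.1 = \int[mu]_y h y.
Proof.
move=> hpi mh h0; rewrite -(integral_push pi measurable_fst mh h0).
by apply/esym; exact: weq_integral (coupling_fst hpi).
Qed.

Lemma coupling_integral2 mu nu pi (h : B -> \bar R) : coupling mu nu pi ->
  measurable_fun setT h -> (forall y, 0 <= h y) ->
  \int[pi]_z h z.2 = \int[nu]_y h y.
Proof.
move=> hpi mh h0; rewrite -(integral_push pi measurable_snd mh h0).
by apply/esym; exact: weq_integral (coupling_snd hpi).
Qed.

Lemma wcost_sym mu nu : wcost p mu nu = wcost p nu mu.
Proof.
wlog suff: mu nu / wcost p mu nu <= wcost p nu mu.
  by move=> h; apply/eqP; rewrite eq_le !h.
apply: wcost_ge => pi hpi.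
have := wcost_le_push (coupling_snd hpi) (coupling_fst hpi).
by under eq_integral do rewrite distrC.
Qed.

Lemma weq_wcost mu nu mu' nu' : weq mu mu' -> weq nu nu' ->
  wcost p mu nu = wcost p mu' nu'.
Proof.
move=> hmu hnu; congr ereal_inf; apply/seteqP; split => _ [pi [hpi ->]];
  exists pi; split => // A mA; have [-> ->] := hpi A mA.
  by rewrite hmu// hnu.
by rewrite hmu// hnu.
Qed.

(** Being a Dirac mass is expressed by [mu [set a] = 1], a condition that the image of a Dirac mass
    can satisfy without being the term [\d_a]. *)
Lemma full_set1 mu (a : E) (A : set B) : mu [set a] = 1 -> measurable A ->
  mu A = (a \in A)%:R%:E.
Proof.
move=> mua mA; have m1 := @borel_set1 R E a.
rewrite (full_setI m1 mA mua); have [aA|aA] := boolP (a \in A).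
  by rewrite setIidl// => _ ->; rewrite inE in aA.
rewrite [X in mu X](_ : _ = set0) ?measure0//.
by apply/seteqP; split => // x [/= -> Aa]; rewrite notin_setE in aA.
Qed.

(** Every coupling with a Dirac mass is carried by [{a} x E], so all couplings have the same
    cost. *)
Lemma wcost_dirac mu nu (a : E) : mu [set a] = 1 -> wcost p mu nu = moment nu a.
Proof.
move=> mua; apply/eqP; rewrite eq_le; apply/andP; split.
  have mc : measurable_fun setT (cst a : B -> B) by exact: measurable_cst.
  apply: (@wcost_le_push _ _ nu _ _ mc (@measurable_id _ _ _)) => //.
  move=> A mA; rewrite (full_set1 mua mA) (pushE nu mc).
  have [aA|aA] := boolP (a \in A).
    rewrite preimage_cst aA.
    by rewrite probability_setT.
  by rewrite preimage_cst (negbTE aA) measure0.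
apply: wcost_ge => pi hpi.
rewrite /moment; have /= <- // := coupling_integral2 hpi (measurable_moment a).
have m1 := @borel_set1 R E a.
rewrite (@eq_integral_full _ _ _ pi ([set (a : B)] `*` setT) _
   (fun z => (`|(z.1 : E) - (z.2 : E)| ^+ p)%:E)) //.
- exact: measurableX.
- by rewrite (hpi _ m1).1.
- exact: (measurableT_comp (measurable_moment a) measurable_snd).
- exact: measurable_cost.
- by move=> [x y] /= [-> _].
Qed.

Lemma coupling_prod mu nu : coupling mu nu (mu \x nu : probability (B * B)%type R).
Proof.
move=> A mA; split.
  have /= -> := product_measure1E mu nu mA measurableT.
  by rewrite probability_setT mule1.
have /= -> := product_measure1E mu nu measurableT mA.
by rewrite probability_setT mul1e.
Qed.

Lemma norm_sub_expr (x y : E) : (0 < p)%N ->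
  (`|x - y| ^+ p <= 2 ^+ p.-1 * (`|x| ^+ p + `|y| ^+ p))%R.
Proof.
move=> p0; rewrite -(prednK p0); apply: le_trans (exprD_le _ _ _) => //.
by rewrite lerXn2r ?nnegrE ?addr_ge0// ler_normB.
Qed.

Lemma measurable_fun_dist d (T : measurableType d) (f g : T -> B) :
  measurable_fun setT f -> measurable_fun setT g ->
  measurable_fun setT (fun t => (`|(f t : E) - (g t : E)| ^+ p)%:E).
Proof.
by move=> mf mg; exact: (measurableT_comp measurable_cost (measurable_fun_pair mf mg)).
Qed.

Lemma measurable_fun_norm d (T : measurableType d) (f : T -> B) :
  measurable_fun setT f -> measurable_fun setT (fun t => (`|(f t : E)| ^+ p)%:E).
Proof.
move=> mf; have := measurableT_comp (measurable_moment 0%R) mf.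
by rewrite /comp; under eq_fun do rewrite sub0r normrN.
Qed.

Lemma integral_dist_le d (T : measurableType d) (P : probability T R)
    (f g : T -> B) : (0 < p)%N ->
  measurable_fun setT f -> measurable_fun setT g ->
  \int[P]_t (`|(f t : E) - (g t : E)| ^+ p)%:E <=
  (2 ^+ p.-1)%:E * (\int[P]_t (`|(f t : E)| ^+ p)%:E +
                    \int[P]_t (`|(g t : E)| ^+ p)%:E).
Proof.
move=> p0 mf mg.
have mf' := measurable_fun_norm mf; have mg' := measurable_fun_norm mg.
rewrite -ge0_integralD// -ge0_integralZl_EFin//.
- apply: ge0_le_integral => //.
  + exact: measurable_fun_dist.
  + by apply: emeasurable_funM => //; exact: emeasurable_funD.
  + by move=> t _; rewrite -EFinD -EFinM lee_fin norm_sub_expr.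
- by move=> t _; rewrite adde_ge0.
- exact: emeasurable_funD.
Qed.

Lemma moment_lty mu a : (0 < p)%N -> finite_moment p mu -> moment mu a < +oo.
Proof.
move=> p0 hmu.
have := integral_dist_le mu p0 (@measurable_cst _ _ B B setT a) (@measurable_id _ B setT).
move=> /le_lt_trans; apply.
have -> : \int[mu]_t (`|cst a t| ^+ p)%:E = (`|a| ^+ p)%:E.
  exact: (integral_cst1 mu (`|a| ^+ p)%:E).
by apply: lte_mul_pinfty => //; rewrite lte_add_pinfty// ltry.
Qed.

Lemma moment_ge0 mu a : 0 <= moment mu a.
Proof. exact: integral_ge0. Qed.

Lemma wcost_fin mu nu : (0 < p)%N -> finite_moment p mu -> finite_moment p nu ->
  wcost p mu nu \is a fin_num.
Proof.
move=> p0 hmu hnu; rewrite ge0_fin_numE ?wcost_ge0//.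
have cpi := coupling_prod mu nu.
have := integral_dist_le (mu \x nu : probability (B * B)%type R) p0
  measurable_fst measurable_snd.
move/(le_trans (wcost_le_push (coupling_fst cpi) (coupling_snd cpi))).
move=> /le_lt_trans; apply.
have mn : measurable_fun setT ((fun y => (`|(y : E)| ^+ p)%:E) : B -> \bar R).
  exact: measurable_fun_norm (@measurable_id _ B setT).
have /= -> // := coupling_integral1 cpi mn.
have /= -> // := coupling_integral2 cpi mn.
by apply: lte_mul_pinfty => //; rewrite lte_add_pinfty.
Qed.

(** Finite moments matter here: [fine] sends an infinite cost to 0, so only finite costs can be
    recovered from distances. *)
Lemma wdist_wcost mu nu mu' nu' : (0 < p)%N ->
  finite_moment p mu -> finite_moment p nu ->
  finite_moment p mu' -> finite_moment p nu' ->
  wdist p mu nu = wdist p mu' nu' -> wcost p mu nu = wcost p mu' nu'.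
Proof.
move=> p0 h1 h2 h3 h4.
rewrite -(fineK (wcost_fin p0 h1 h2)) -(fineK (wcost_fin p0 h3 h4)) /wdist.
have := fine_ge0 (wcost_ge0 mu nu); have := fine_ge0 (wcost_ge0 mu' nu').
move: (fine _) (fine _) => y x y0 x0 /(congr1 (fun r => powR r p%:R)).
by rewrite -!powRrM mulVf ?pnatr_eq0 -?lt0n// !powRr1// => ->.
Qed.

(** Apply to [nu] the homothety [y |-> 2y - a], written [y - (a - y)]: it moves [y] by [|a - y|] and
    doubles the distance to [a], whence the factor [2 ^+ p] at the level of costs. *)
Lemma dirac_extension mu nu (a : E) : (0 < p)%N -> mu [set a] = 1 ->
  finite_moment p nu ->
  exists eta : probability B R, [/\ finite_moment p eta,
    wcost p nu eta <= wcost p mu nu &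
    (2 ^+ p)%:E * wcost p mu nu <= wcost p mu eta].
Proof.
move=> p0 mua hnu.
have mg : measurable_fun setT ((fun y => a - y)%R : B -> B).
  by apply: borel_fun => y; apply: cvgB => //; exact: cvg_cst.
have mf : measurable_fun setT ((fun y => y - (a - y))%R : B -> B).
  apply: borel_fun => y; apply: cvgB => //; apply: cvgB => //; exact: cvg_cst.
exists (push nu mf); split.
- rewrite /finite_moment (integral_push nu mf (measurable_fun_norm (@measurable_id _ B setT)))//.
  apply: le_lt_trans (integral_dist_le nu p0 (@measurable_id _ B setT) mg) _.
  by apply: lte_mul_pinfty => //; rewrite lte_add_pinfty//; exact: moment_lty.
- rewrite (wcost_dirac _ mua).
  have := @wcost_le_push _ _ nu _ _ (@measurable_id _ B setT) mf nu (push nu mf).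
  move=> /(_ (fun _ _ => erefl) (fun _ _ => erefl)) /le_trans; apply.
  by under eq_integral do rewrite subKr.
- rewrite !(wcost_dirac _ mua) /moment (integral_push nu mf (measurable_moment a))//.
  rewrite -ge0_integralZl_EFin//; last exact: measurable_moment.
  apply: ge0_le_integral => //.
  + by apply: emeasurable_funM => //; exact: measurable_moment.
  + by apply: measurableT_comp (measurable_moment a) mf.
  + move=> y _; rewrite -EFinM lee_fin -exprMn.
    rewrite (_ : a - (y - (a - y)) = 2%:R *: (a - y))%R.
      by rewrite normrZ normr_nat.
    by rewrite scaler_nat mulr2n opprB addrCA addrA.
Qed.

(** Converse of [dirac_extension], needed only when the middle measure [nu] is the Dirac mass at 0:
    doubling forces equality in [|x - y|^p <= 2^(p-1) (|x|^p + |y|^p)], that is [x = -y]. *)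
Lemma extension_dirac (ip : E -> E -> R) k mu eta (nu : probability B R) :
  inner_product ip -> p = k.+1.*2 -> nu [set 0%R] = 1 ->
  finite_moment p mu -> finite_moment p eta ->
  wcost p nu eta <= wcost p mu nu ->
  (2 ^+ p)%:E * wcost p mu nu <= wcost p mu eta ->
  exists a : E, mu [set a] = 1.
Proof.
move=> hip pk nu0 hmu heta.
have p0 : (0 < p)%N by rewrite pk.
rewrite (wcost_sym mu) !(wcost_dirac _ nu0) => le1 le2.
(* The independent coupling, not an optimal one: [x = -y] for independent [x] and [y] makes both of
   them constant. *)
have cpi := coupling_prod mu eta.
set pi := (mu \x eta : probability (B * B)%type R) in cpi.
pose G (z : B * B) := (2 ^+ p.-1 * (`|z.1 : E| ^+ p + `|z.2 : E| ^+ p)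
  - `|(z.1 : E) - (z.2 : E)| ^+ p)%R.
have m1 : measurable_fun setT (fun z : B * B => (`|z.1 : E| ^+ p)%R).
  by apply/measurable_EFinP; exact: (measurable_fun_norm measurable_fst).
have m2 : measurable_fun setT (fun z : B * B => (`|z.2 : E| ^+ p)%R).
  by apply/measurable_EFinP; exact: (measurable_fun_norm measurable_snd).
have mG : measurable_fun setT (fun z => (G z)%:E).
  apply/measurable_EFinP; apply: measurable_funB; last first.
    by apply: measurable_funX; exact: measurable_dist.
  by apply: measurable_funM => //; exact: measurable_funD.
have G0 z : 0 <= (G z)%:E by rewrite lee_fin subr_ge0 norm_sub_expr.
have mn : measurable_fun setT ((fun y => (`|0 - (y : E)| ^+ p)%:E) : B -> \bar R).
  exact: measurable_moment.
have int1 : \int[pi]_z (`|z.1 : E| ^+ p)%:E = moment mu 0%R.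
  rewrite /moment; have /= <- // := coupling_integral1 cpi mn.
  by apply: eq_integral => z _; rewrite sub0r normrN.
have int2 : \int[pi]_z (`|z.2 : E| ^+ p)%:E = moment eta 0%R.
  rewrite /moment; have /= <- // := coupling_integral2 cpi mn.
  by apply: eq_integral => z _; rewrite sub0r normrN.
have intG : \int[pi]_z (G z)%:E = 0.
  apply/eqP; rewrite eq_le; apply/andP; split; last exact: integral_ge0.
  (* The left side is [2^(p-1)] times the sum of the moments of [mu] and [eta] at 0. By [le1] this
     is at most [2^p] times that of [mu], and by [le2] at most the cost of any coupling. *)
  have : \int[pi]_z ((G z)%:E + (`|(z.1 : E) - (z.2 : E)| ^+ p)%:E) <=
         \int[pi]_z (`|(z.1 : E) - (z.2 : E)| ^+ p)%:E.
    have h : \int[pi]_z (`|(z.1 : E) - (z.2 : E)| ^+ p)%:E >=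
       (2 ^+ p)%:E * moment mu 0%R.
      apply: le_trans le2 _.
      exact: (wcost_le_push (coupling_fst cpi) (coupling_snd cpi)).
    apply: le_trans _ h.
    under eq_integral do rewrite -EFinD subrK EFinM.
    rewrite ge0_integralZl_EFin//; last first.
      exact/measurable_EFinP/measurable_funD.
    under eq_integral do rewrite EFinD.
    rewrite ge0_integralD//; [|exact/measurable_EFinP|exact/measurable_EFinP].
    rewrite int1 int2.
    have -> : (2 ^+ p)%:E = (2 ^+ p.-1)%:E * 2%:E :> \bar R.
      by rewrite -EFinM -exprSr prednK.
    rewrite -muleA lee_pmul2l ?lte_fin ?exprn_gt0//.
    by rewrite mule_natl mule2n leeD2l.
  rewrite ge0_integralD//; last exact: measurable_cost.
  rewrite -[leRHS]add0e leeD2rE// ge0_fin_numE; last exact: integral_ge0.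
  apply: le_lt_trans (integral_dist_le pi p0 measurable_fst measurable_snd) _.
  rewrite int1 int2; apply: lte_mul_pinfty => //.
  by rewrite lte_add_pinfty// moment_lty.
have fG0 : measurable_fun setT (fubini_G mu (fun z => (G z)%:E)).
  exact: measurable_fun_fubini_tonelli_G.
have : \int[eta]_y fubini_G mu (fun z => (G z)%:E) y = 0.
  by rewrite -(fubini_tonelli2 _ mG G0).
move=> /(integral_eq0_ae fG0) aez.
(* By Fubini one good point [z] of [eta] is enough: [mu]-almost every [y] then equals [-z]. *)
have [|z] := ae_exists (aez _).
  by move=> z; apply: integral_ge0.
rewrite /fubini_G => /integral_eq0_ae aeG.
exists (- z)%R; apply: ae_full; first exact: borel_set1.
apply: filterS (aeG _ _) => //.
  move=> y [] /eqP; rewrite subr_eq0 pk => /eqP /=.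
  exact: (norm_sub_expr_eq hip).
exact: (measurableT_comp mG (pair2_measurable z)).
Qed.

End couplings.

(** * Coefficient extraction by interpolation; tangent inequality for powers *)

Section coefficient.
Variable R : realFieldType.
Local Notation s i := (i.+1%:R : R).

(** The weights come from the inverse Vandermonde matrix and do not depend on [q], so extraction
    commutes with integration. The nodes [1, ..., n] avoid 0 because [quad_comb] divides by them. *)
Lemma coef_interpolation n (j : 'I_n) : exists w : 'I_n -> R,
  forall q : {poly R}, (size q <= n)%N -> q`_j = \sum_i w i * q.[s i].
Proof.
pose a : 'rV[R]_n := \row_i s i; pose V := Vandermonde n a.
have uV : V \in unitmx.
  rewrite unitmxE unitfE det_Vandermonde; apply/prodf_neq0 => i _.
  apply/prodf_neq0 => l il; rewrite !mxE subr_eq0 eqr_nat eqSS.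
  by rewrite neq_ltn il orbT.
exists (fun i => invmx V i j) => q sq.
pose c : 'rV[R]_n := \row_i q`_i.
have cV : c *m V = \row_i q.[s i].
  apply/rowP => i; rewrite !mxE (horner_coef_wide _ sq).
  by apply: eq_bigr => l _; rewrite !mxE.
have : c = (\row_i q.[s i]) *m invmx V by rewrite -cV mulmxK.
move=> /rowP /(_ j); rewrite !mxE => ->.
by apply: eq_bigr => i _; rewrite !mxE mulrC.
Qed.

(** Only the coefficient of degree 2 is wanted; the other two are carried for the induction. *)
Lemma coef_quadratic_exp (b c : R) k :
  let q := (1 + b *: 'X + c *: 'X^2) ^+ k in
  [/\ q`_0 = 1, q`_1 = k%:R * b & q`_2 = k%:R * c + 'C(k, 2)%:R * b ^+ 2].
Proof.
elim: k => [|k [h0 h1 h2]] /=.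
  by rewrite expr0 !coefC/= !mul0r addr0.
rewrite exprSr !coefM !big_ord_recl !big_ord0 /= /bump/= h0 h1 h2.
rewrite !coefD !coefZ !coefX !coefXn !coef1 /=.
split; first by ring.
  by rewrite -[k.+1]addn1 natrD; ring.
by rewrite binS bin1 -[k.+1]addn1 !natrD; ring.
Qed.

Lemma size_quadratic_exp (b c : R) k :
  (size ((1 + b *: 'X + c *: 'X^2) ^+ k : {poly R})%R <= k.*2.+1)%N.
Proof.
elim: k => [|k ih]; first by rewrite expr0 size_poly1.
rewrite exprS (leq_trans (size_polyMleq _ _))//.
have : (size (1 + b *: 'X + c *: 'X^2 : {poly R})%R <= 3)%N.
  rewrite (leq_trans (size_polyD _ _))// geq_max; apply/andP; split.
    rewrite (leq_trans (size_polyD _ _))// geq_max size_poly1/=.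
    by rewrite (leq_trans (size_scale_leq _ _))// size_polyX.
  by rewrite (leq_trans (size_scale_leq _ _))// size_polyXn.
move: (size _) (size _) ih => u v hu hv.
by rewrite -subn1 leq_subLR add1n doubleS; exact: (leq_add hv hu).
Qed.

(** The graph of a power lies above its tangent at [D]. Raising the exponent by one multiplies the
    deficit by [t] and adds a nonnegative multiple of [(t - D)^2]; this added square also gives the
    equality case below. *)
Lemma expr_tangent_ge (t D : R) k : 0 <= t -> 0 <= D ->
  0 <= t ^+ k.+1 + k%:R * D ^+ k.+1 - k.+1%:R * D ^+ k * t.
Proof.
move=> t0 D0; elim: k => [|k ih]; first by rewrite !expr1 expr0; lra.
have -> : t ^+ k.+2 + k.+1%:R * D ^+ k.+2 - k.+2%:R * D ^+ k.+1 * t =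
  t * (t ^+ k.+1 + k%:R * D ^+ k.+1 - k.+1%:R * D ^+ k * t)
  + k.+1%:R * D ^+ k * (t - D) ^+ 2.
  by rewrite -[k.+2]addn2 -[k.+1]addn1 !natrD !exprD; ring.
apply: addr_ge0; first exact: mulr_ge0.
by apply: mulr_ge0; [rewrite mulr_ge0 ?exprn_ge0|exact: sqr_ge0].
Qed.

Lemma expr_tangent_eq (t D : R) k : 0 <= t -> 0 < D ->
  t ^+ k.+2 + k.+1%:R * D ^+ k.+2 - k.+2%:R * D ^+ k.+1 * t = 0 -> t = D.
Proof.
move=> t0 D0.
have -> : t ^+ k.+2 + k.+1%:R * D ^+ k.+2 - k.+2%:R * D ^+ k.+1 * t =
  t * (t ^+ k.+1 + k%:R * D ^+ k.+1 - k.+1%:R * D ^+ k * t)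
  + k.+1%:R * D ^+ k * (t - D) ^+ 2.
  by rewrite -[k.+2]addn2 -[k.+1]addn1 !natrD !exprD; ring.
have tD0 : 0 <= k.+1%:R * D ^+ k * (t - D) ^+ 2.
  by apply: mulr_ge0; [rewrite mulr_ge0 ?exprn_ge0// ltW|exact: sqr_ge0].
move=> /eqP; rewrite paddr_eq0//; last by rewrite mulr_ge0// expr_tangent_ge// ltW.
move=> /andP[_]; rewrite mulf_eq0 mulf_eq0 pnatr_eq0 expf_eq0 (gt_eqF D0) andbF/=.
by rewrite sqrf_eq0 subr_eq0 => /eqP.
Qed.
End coefficient.

(** * Potentials determine the measures carried by two points *)

Section two_points.
Context {R : realType} {E : normedModType R}.
Local Notation B := (@borelE R E).
Variable ip : E -> E -> R.
Hypothesis hip : inner_product ip.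

Definition quad k (x y : E) : R := k%:R * `|y| ^+ 2 + (4 * 'C(k, 2))%:R * ip x y ^+ 2.

(* [quad k x y] is the coefficient of [s ^+ 2] in [`|x - s *: y| ^+ k.*2]. *)
Lemma quad_comb k : exists n (w s : 'I_n -> R), forall x y : E, `|x| = 1 ->
  quad k x y = \sum_i w i * `|s i *: x - y| ^+ k.*2.
Proof.
case: k => [|k].
  by exists 0%N, (fun=> 0), (fun=> 0) => x y _; rewrite big_ord0 /quad !mul0r addr0.
have hj : (2 < k.+1.*2.+1)%N by rewrite doubleS.
have [w hw] := @coef_interpolation R k.+1.*2.+1 (Ordinal hj).
exists k.+1.*2.+1, (fun i => w i * i.+1%:R ^+ k.+1.*2), (fun i => i.+1%:R^-1) => x y x1.
have := hw _ (size_quadratic_exp (-2 * ip x y) (`|y| ^+ 2) k.+1) => /=.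
(* The polynomial in [r] is [|x - r y|^(2k+2)]. At a node [r] it equals [r^(2k+2) |x/r - y|^(2k+2)],
   a multiple of the integrand of the potential at [x/r]; this explains the witnesses. *)
have [_ _ ->] := coef_quadratic_exp (-2 * ip x y) (`|y| ^+ 2) k.+1.
rewrite /quad natrM => h; apply: etrans (etrans h _).
  by rewrite exprMn sqrrN; ring.
apply: eq_bigr => i _; rewrite -mulrA; congr (_ * _).
have i0 : i.+1%:R != 0 :> R by rewrite pnatr_eq0.
have hi : i.+1%:R * `|i.+1%:R^-1 *: x - y| = `|x - i.+1%:R *: y|.
  by rewrite -[X in X * _]ger0_norm// -normrZ scalerBr scalerA mulfV// scale1r.
rewrite -exprMn hi => {hi i0}; move: (i.+1%:R : R) (ler0n R i.+1) => r r0.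
rewrite -mul2n exprM horner_exp (normB2 hip) !hornerE /=; congr (_ ^+ _).
by rewrite x1 (ipZr hip) normrZ ger0_norm// ; ring.
Qed.

Local Open Scope ereal_scope.

Lemma integral_quad k (mu nu : probability B R) (x m : E) : (0 < k)%N ->
  @separable R E -> finite_moment k.*2 mu -> finite_moment k.*2 nu ->
  (forall a, moment k.*2 mu a = moment k.*2 nu a) -> `|x|%R = 1%R ->
  \int[mu]_y (quad k x ((y : E) - m))%:E = \int[nu]_y (quad k x ((y : E) - m))%:E.
Proof.
move=> k0 hsep hmu hnu mom x1; have [n [w [s hws]]] := quad_comb k.
have k20 : (0 < k.*2)%N by rewrite double_gt0.
suff key la : finite_moment k.*2 la ->
    \int[la]_y (quad k x ((y : E) - m))%:E =
    \sum_i (w i)%:E * moment k.*2 la (m + s i *: x)%R.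
  by rewrite !key//; apply: eq_bigr => i _; rewrite mom.
move=> hla.
under eq_integral => y _.
  rewrite hws// -sumEFin.
  under eq_bigr => i _ do rewrite opprB addrCA addrA EFinM.
  over.
(* The weights may have either sign, so linearity needs integrability and not just nonnegativity. *)
have int i : la.-integrable setT
    (fun y : B => (`|m + s i *: x - (y : E)| ^+ k.*2)%:E).
  apply/integrableP; split; first exact: measurable_moment.
  by under eq_integral do rewrite gee0_abs ?cost_ge0//; exact: moment_lty.
rewrite integral_sum//; last by move=> i; exact: integrableZl.
by apply: eq_bigr => i _; rewrite integralZl.
Qed.

Lemma adde_fin_eq0 (x : \bar R) (c : R) : x + c%:E = c%:E -> x = 0.
Proof. by case: x => [x| |]//= [] h; congr (_%:E); move: h; lra. Qed.

Lemma measurable_ipB x m : measurable_fun setT ((fun y => ip x ((y : E) - m)%R) : B -> R).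
Proof.
under eq_fun do rewrite (ipBr hip).
by apply: measurable_funB => //; exact: ip_measurable.
Qed.

Lemma two_points_full k (mu nu : probability B R) (a b : E) :
  @separable R E -> finite_moment k.+2.*2 mu -> finite_moment k.+2.*2 nu ->
  (forall a, moment k.+2.*2 mu a = moment k.+2.*2 nu a) -> a != b ->
  mu [set a; b] = 1 -> nu [set a; b] = 1.
Proof.
move=> hsep hmu hnu mom ab muS.
have mS : measurable ([set a; b] : set B).
  by apply: measurableU; exact: borel_set1.
(* Seen from the midpoint the two points are [d] and [-d]; [quad] is even, hence constant on them,
   and its [mu]-integral is explicit. *)
pose m := (2^-1 *: (a + b))%R; pose d := (2^-1 *: (a - b))%R.
have hh : (2^-1 + 2^-1 = 1 :> R)%R by lra.
have am : (a - m = d)%R.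
  rewrite -[X in (X - _)%R]scale1r -hh /m /d scalerDl !scalerDr scalerN.
  by rewrite opprD addrACA subrr add0r.
have bm : (b - m = - d)%R.
  rewrite -[X in (X - _)%R]scale1r -hh /m /d scalerDl !scalerDr scalerN.
  by rewrite opprD opprB addrACA [(_ + - _)%R]addrC subrr addr0 addrC.
have d0 : (d != 0)%R by rewrite scaler_eq0 invr_eq0 pnatr_eq0/= subr_eq0.
pose r := `|d|%R; have r0 : (0 < r)%R by rewrite normr_gt0.
pose e := (r^-1 *: d)%R; pose D := (r ^+ 2)%R.
have D0 : (0 < D)%R by rewrite exprn_gt0.
have e1 : `|e|%R = 1%R by rewrite normrZ gtr0_norm ?invr_gt0// mulVf ?gt_eqF.
have re : d = (r *: e)%R by rewrite scalerA mulfV ?gt_eqF// scale1r.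
have ed : (ip e d ^+ 2 = D)%R by rewrite re (ipZr hip) (ipxx hip) e1 expr1n mulr1.
clearbody e.
pose K : R := k.+2%:R; pose C4 : R := (4 * 'C(k.+2, 2))%:R.
have K0 : (0 < K)%R by rewrite ltr0n.
have C40 : (0 < C4)%R by rewrite ltr0n muln_gt0 bin_gt0.
have mN : measurable_fun setT (fun y : B => (`|(y : E) - m| ^+ 2)%R).
  by apply: measurable_funX; exact: borel_dist.
have mI x : measurable_fun setT (fun y : B => (ip x ((y : E) - m) ^+ 2)%R).
  by apply: measurable_funX; exact: measurable_ipB.
pose V := \int[nu]_y (`|(y : E) - m| ^+ 2)%:E.
pose W x := \int[nu]_y (ip x ((y : E) - m) ^+ 2)%:E.
have N0 (y : B) : 0 <= (`|(y : E) - m| ^+ 2)%:E :> \bar R by rewrite lee_fin sqr_ge0.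
have I0 x (y : B) : 0 <= (ip x ((y : E) - m) ^+ 2)%:E :> \bar R by rewrite lee_fin sqr_ge0.
have V0 : 0 <= V by exact: integral_ge0.
have W0 x : 0 <= W x by exact: integral_ge0.
have iQ x : `|x|%R = 1%R -> K%:E * V + C4%:E * W x = (K * D + C4 * ip x d ^+ 2)%:E.
  move=> x1; have := @integral_quad k.+2 mu nu x m isT hsep hmu hnu mom x1.
  rewrite (@eq_integral_full _ _ _ mu _ _ (cst (K * D + C4 * ip x d ^+ 2)%:E) mS muS)//.
  - rewrite integral_cst1 => ->.
    rewrite (_ : \int[nu]_y _ = \int[nu]_y (K%:E * (`|(y : E) - m| ^+ 2)%:E +
      C4%:E * (ip x ((y : E) - m) ^+ 2)%:E)); last first.
      by apply: eq_integral => y _; rewrite -!EFinM -EFinD.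
    rewrite ge0_integralD//; last 4 first.
    + by move=> y _; rewrite mule_ge0// lee_fin ler0n.
    + by apply: emeasurable_funM => //; exact/measurable_EFinP.
    + by move=> y _; rewrite mule_ge0// lee_fin ler0n.
    + by apply: emeasurable_funM => //; exact/measurable_EFinP.
    rewrite ge0_integralZl_EFin ?ler0n//; last exact/measurable_EFinP.
    by rewrite ge0_integralZl_EFin ?ler0n//; exact/measurable_EFinP.
  - apply/measurable_EFinP; apply: measurable_funD; apply: measurable_funM => //.
  - move=> y [] ->; rewrite /quad ?am ?bm ?normrN ?(ipNr hip) ?sqrrN//.
have Qe : K%:E * V + C4%:E * W e = (K * D + C4 * D)%:E by rewrite iQ// ed.
have Vfin : V \is a fin_num.
  rewrite ge0_fin_numE// ltey; apply/eqP => Voo; move: Qe.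
  by rewrite Voo gt0_muley// addye// gt_eqF// (lt_le_trans ltNy0)// mule_ge0// lee_fin ltW.
have Wfin : W e \is a fin_num.
  rewrite ge0_fin_numE// ltey; apply/eqP => Voo; move: Qe.
  by rewrite Voo gt0_muley// addey// gt_eqF// (lt_le_trans ltNy0)// mule_ge0// lee_fin ltW.
have WV : W e <= V.
  apply: ge0_le_integral => //; [exact/measurable_EFinP|exact/measurable_EFinP|].
  by move=> y _; rewrite lee_fin -subr_ge0 -(ip_unit hip)// sqr_ge0.
(* With [x] orthogonal to [d], [iQ] reads [K V + C4 W(x) = K D], and the second term is nonnegative.
   If no such unit vector exists, [E] is the line of [e], so [W e = V] and the identity at [e] gives
   equality. *)
have VD : V <= D%:E.
  have [[x [x1 xd]]|nox] := pselect (exists x, `|x|%R = 1%R /\ ip x d = 0%R).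
    have := iQ x x1; rewrite xd expr0n mulr0 addr0 => h.
    have : K%:E * V <= (K * D)%:E by rewrite -h leeDl// mule_ge0// lee_fin ltW.
    by rewrite EFinM lee_pmul2l// lte_fin.
  have hy y : (`|y| ^+ 2 = ip e y ^+ 2)%R.
    apply/eqP; rewrite -subr_eq0 -(ip_unit hip)// sqrf_eq0 normr_eq0.
    apply: contrapT => /negP z0; apply: nox.
    set z := (y - _)%R in z0; exists (`|z|^-1 *: z)%R; split.
      by rewrite normrZ normfV normr_id mulVf ?normr_eq0.
    rewrite re !(ipZl hip) (ipZr hip) /z (ipBl hip) (ipZl hip) (ipxx hip) e1.
    by rewrite expr1n mulr1 (ipC hip) subrr !mulr0.
  have VW : W e = V by apply: eq_integral => y _; rewrite hy.
  move: Qe; rewrite VW -(fineK Vfin) => -[] /eqP.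
  by rewrite -!mulrDl => /eqP/mulfI ->//; rewrite gt_eqF// addr_gt0.
(* [V <= D] in the identity at [e] gives [D <= W e], because [C4 > 0]; this closes the chain
   [D <= W e <= V <= D]. *)
have [VDe WDe] : V = D%:E /\ W e = D%:E.
  move: Qe WV VD; rewrite -(fineK Vfin) -(fineK Wfin).
  move: (fine V) (fine (W e)) => v w [] q; rewrite !lee_fin => wv vD.
  have Dw : (D <= w)%R.
    rewrite -(ler_pM2l C40) -(lerD2l (K * D)%R) -q lerD2r ler_pM2l//.
  by split; congr (_%:E); apply/eqP; rewrite eq_le; apply/andP; split; lra.
have ae1 : {ae nu, forall y : B, (`|(y : E) - m| ^+ 2 - ip e ((y : E) - m) ^+ 2)%:E = 0}.
  apply: integral_eq0_ae.
  - by apply/measurable_EFinP; exact: measurable_funB.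
  - by move=> y; rewrite lee_fin -(ip_unit hip)// sqr_ge0.
  apply: (@adde_fin_eq0 _ D); rewrite -{1}WDe -ge0_integralD//.
  - by rewrite -{}VDe; apply: eq_integral => y _; rewrite -EFinD subrK.
  - by move=> y; rewrite lee_fin -(ip_unit hip)// sqr_ge0.
  - by apply/measurable_EFinP; exact: measurable_funB.
  - exact/measurable_EFinP.
(* Jensen deficit of the power [k+2] at [D]. Its integral vanishes: [|y - m|^2] has mean [D] under
   [nu], and its power [k+2] has mean [D^(k+2)], as the potentials at [m] agree. *)
pose g t : R := (t ^+ k.+2 + k.+1%:R * D ^+ k.+2 - k.+2%:R * D ^+ k.+1 * t)%R.
have g0 (y : B) : 0 <= (g (`|(y : E) - m| ^+ 2)%R)%:E :> \bar R.
  by rewrite lee_fin expr_tangent_ge// ?sqr_ge0// ltW.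
have mg : measurable_fun setT (fun y : B => (g (`|(y : E) - m| ^+ 2)%R)%:E).
  apply/measurable_EFinP; apply: measurable_funB.
    by apply: measurable_funD => //; exact: measurable_funX.
  exact: measurable_funM.
have ae2 : {ae nu, forall y : B, (g (`|(y : E) - m| ^+ 2)%R)%:E = 0}.
  apply: integral_eq0_ae => //.
  apply: (@adde_fin_eq0 _ (k.+2%:R * D ^+ k.+1 * D)%R); rewrite {1}EFinM -{1}VDe.
  have c0 : (0 <= k.+2%:R * D ^+ k.+1)%R by rewrite mulr_ge0 ?exprn_ge0// ltW.
  rewrite -ge0_integralZl_EFin//; last exact/measurable_EFinP.
  rewrite -ge0_integralD//; last 2 first.
  - by move=> y _; rewrite mule_ge0.
  - by apply: emeasurable_funM => //; exact/measurable_EFinP.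
  under eq_integral do rewrite -EFinM -EFinD subrK EFinD -exprM.
  rewrite ge0_integralD//; last 2 first.
  - by apply/measurable_EFinP; apply: measurable_funX; exact: borel_dist.
  - by move=> y _; rewrite lee_fin mulr_ge0// exprn_ge0// ltW.
  rewrite integral_cst1.
  have -> : \int[nu]_y (`|(y : E) - m| ^+ (2 * k.+2))%:E = moment k.+2.*2 nu m.
    by rewrite mul2n; apply: eq_integral => y _; rewrite distrC.
  rewrite -mom /moment.
  rewrite (@eq_integral_full _ _ _ mu _ _ (cst (D ^+ k.+2)%:E) mS muS)//.
  - rewrite integral_cst1 -EFinD; congr (_%:E).
    by rewrite -mulrA -exprSr -[(k.+2%:R)%R]natr1 mulrDl mul1r addrC.
  - exact: measurable_moment.
  - by move=> y []->; rewrite distrC ?am ?bm ?normrN -mul2n exprM.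
apply: ae_full => //; apply: filterS2 ae1 ae2 => y [] /eqP + [].
rewrite subr_eq0 => /eqP n1 /(expr_tangent_eq (sqr_ge0 _) D0) n2.
(* Equality in Cauchy-Schwarz puts [y - m] on the line of [e], equality in Jensen gives it length
   [r]: only [d] and [-d] remain. *)
have : (y - m = ip e (y - m) *: e)%R.
  by apply/eqP; rewrite -subr_eq0 -normr_eq0 -sqrf_eq0 (ip_unit hip)// n1 subrr.
move: n1; rewrite n2 => /eqP; rewrite eq_sym eqf_sqr => /orP[]/eqP ->.
  by rewrite -re -am => /addIr ->; left.
by rewrite scaleNr -re -bm => /addIr ->; right.
Qed.

(** Once the support is known, the potential at one point is a positive multiple of the mass at the
    other. *)
Lemma two_points_weq k (mu nu : probability B R) (a b : E) :
  @separable R E -> finite_moment k.+2.*2 mu -> finite_moment k.+2.*2 nu ->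
  (forall a, moment k.+2.*2 mu a = moment k.+2.*2 nu a) -> a != b ->
  mu [set a; b] = 1 -> weq mu nu.
Proof.
move=> hsep hmu hnu mom ab muS.
have nuS := two_points_full hsep hmu hnu mom ab muS.
have mS : measurable ([set a; b] : set B).
  by apply: measurableU; exact: borel_set1.
have key (x y : E) : [set a; b] = [set x; y] -> x != y -> mu [set y] = nu [set y].
  move=> Sxy xy.
  have h (la : probability B R) : la [set a; b] = 1 ->
      moment k.+2.*2 la x = (`|x - y| ^+ k.+2.*2)%:E * la [set y].
    move=> laS; have my := @borel_set1 R E y.
    rewrite /moment (@eq_integral_full _ _ _ la _ _
      (fun z => (`|x - y| ^+ k.+2.*2)%:E * (\1_[set (y : B)] z)%:E) mS laS).
    - rewrite ge0_integralZl_EFin ?exprn_ge0// ?integral_indic ?setIT//.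
      by apply/measurable_EFinP; exact: measurable_indic.
    - exact: measurable_moment.
    - apply: emeasurable_funM => //.
      by apply/measurable_EFinP; exact: measurable_indic.
    - rewrite Sxy => z []->; rewrite indicE.
        by rewrite subrr normr0 expr0n memNset ?mule0//= => /eqP; rewrite (negbTE xy).
      by rewrite mem_set// mule1.
  have := mom x; rewrite (h _ muS) (h _ nuS) => /eqP.
  have xy0 : 0 < (`|x - y| ^+ k.+2.*2)%:E :> \bar R.
    by rewrite lte_fin exprn_gt0// normr_gt0 subr_eq0.
  by rewrite eq_le !lee_pmul2l// -eq_le => /eqP.
have hb := key a b erefl ab.
have ha : mu [set a] = nu [set a] by apply: (key b a); rewrite 1?setUC 1?eq_sym.
move=> A mA; rewrite (full_setI mS mA muS) (full_setI mS mA nuS) setIUl.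
have s1 (x : E) : [set x] `&` A = if x \in A then [set x] else set0.
  case: ifPn => xA; apply/seteqP; split => // z.
  - by move=> ->; split => //; exact: set_mem.
  - by move=> [-> Ax]; move: xA; rewrite mem_set.
rewrite !s1; case: ifPn => _; case: ifPn => _; rewrite ?setU0 ?set0U//.
  by rewrite muS nuS.
by rewrite !measure0.
Qed.

End two_points.

(** * Costs to two-point measures determine the masses of half-spaces *)

Section half_spaces.
Context {R : realType} {E : normedModType R}.
Local Notation B := (@borelE R E).
Hypothesis hsep : @separable R E.
Variable p : nat.
Hypothesis p0 : (0 < p)%N.
Implicit Types mu nu : probability B R.
Local Open Scope ereal_scope.

(* The Legendre transform in the mass at [b] of the cost of transporting [mu] to the measures supported by [{a, b}]. *)
Definition split_cost mu (a b : E) (s : R) : \bar R :=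
  \int[mu]_y (Num.min (`|(y : E) - a| ^+ p) (`|(y : E) - b| ^+ p + s))%:E.

Lemma measurable_distX (a : E) : measurable_fun setT ((fun y => `|y - a| ^+ p)%R : B -> R).
Proof. by apply: measurable_funX; exact: borel_dist. Qed.

Lemma measurable_split (a b : E) s : measurable_fun setT
  ((fun y => Num.min (`|y - a| ^+ p) (`|y - b| ^+ p + s))%R : B -> R).
Proof.
apply: measurable_minr; first exact: measurable_distX.
by apply: measurable_funD => //; exact: measurable_distX.
Qed.

Lemma split_ge0 (a b : E) s (y : E) : (0 <= s)%R ->
  (0 <= Num.min (`|y - a| ^+ p) (`|y - b| ^+ p + s))%R.
Proof. by move=> s0; rewrite le_min exprn_ge0// addr_ge0// exprn_ge0. Qed.

(** Weak duality: regard [s] as a surcharge for arriving at [b]. Any plan then pays at least the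
    cheaper of the two options at each point. *)
Lemma split_cost_le mu (tau : probability B R) (a b : E) (s : R) :
  (0 <= s)%R -> tau [set a; b] = 1 ->
  split_cost mu a b s <= wcost p mu tau + s%:E * tau [set b].
Proof.
move=> s0 tauS.
have mb := @borel_set1 R E b.
have mS : measurable ([set a; b] : set B).
  by apply: measurableU; exact: borel_set1.
have stau : s%:E * tau [set b] \is a fin_num by rewrite fin_numM// fin_num_measure.
rewrite -leeBlDr//; apply: wcost_ge => pi hpi; rewrite leeBlDr//.
have ms := measurable_split a b s.
have ind0 (z : B) : 0 <= (\1_[set (b : B)] z)%:E :> \bar R by rewrite lee_fin indicE.
have mind : measurable_fun setT (fun z : B => (\1_[set (b : B)] z)%:E : \bar R).
  by apply/measurable_EFinP; exact: measurable_indic.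
have mind2 : measurable_fun setT (fun z : B * B => (\1_[set (b : B)] z.2)%:E : \bar R).
  exact: (measurableT_comp mind measurable_snd).
have -> : s%:E * tau [set b] = \int[pi]_z (s%:E * (\1_[set (b : B)] z.2)%:E).
  have <- : \int[tau]_z (\1_[set (b : B)] z)%:E = tau [set b].
    by rewrite integral_indic// setIT.
  by rewrite -(coupling_integral2 hpi mind ind0) -ge0_integralZl_EFin.
have mc : measurable_fun setT (fun z : B * B => s%:E * (\1_[set (b : B)] z.2)%:E).
  exact: emeasurable_funM.
have sind0 (z : B * B) : 0 <= s%:E * (\1_[set (b : B)] z.2)%:E.
  by rewrite mule_ge0.
have mcost := @measurable_cost R E hsep p.
rewrite -ge0_integralD//.
pose h (y : B) := (Num.min (`|(y : E) - a| ^+ p) (`|(y : E) - b| ^+ p + s))%:E : \bar R.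
have mh : measurable_fun setT h by exact/measurable_EFinP.
have h0 y : 0 <= h y by rewrite lee_fin split_ge0.
rewrite /split_cost -(coupling_integral1 hpi mh h0).
apply: ae_ge0_le_integral => //.
- exact: (measurableT_comp mh measurable_fst).
- by move=> z _; rewrite adde_ge0// cost_ge0.
- exact: emeasurable_funD.
apply: (@full_ae _ _ _ pi (setT `*` [set a; b])).
- exact: measurableX.
- by rewrite (hpi _ mS).2.
move=> [x y] /= [_ yab] _; rewrite -EFinM -EFinD lee_fin ge_min.
case: yab => ->; first by rewrite lerDl mulr_ge0.
by apply/orP; right; rewrite indicE mem_set// mulr1.
Qed.

(** The bound of [split_cost_le] is attained by sending every point to its cheaper target; ties go
    to [b]. *)
Lemma split_cost_ge mu (a b : E) (s : R) : (0 <= s)%R -> a != b ->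
  exists tau : probability B R, [/\ finite_moment p tau, tau [set a; b] = 1 &
    wcost p mu tau + s%:E * tau [set b] <= split_cost mu a b s].
Proof.
move=> s0 ab.
have mb := @borel_set1 R E b.
have mS : measurable ([set a; b] : set B).
  by apply: measurableU; exact: borel_set1.
pose t (y : B) := (`|(y : E) - a| ^+ p < `|(y : E) - b| ^+ p + s)%R.
pose f (y : B) : B := if t y then a else b.
have mt : measurable_fun setT t.
  apply: measurable_fun_ltr; first exact: measurable_distX.
  by apply: measurable_funD => //; exact: measurable_distX.
have mf : measurable_fun setT f by apply: measurable_fun_ifT => //.
have mind : measurable_fun setT (fun z : B => (\1_[set (b : B)] z)%:E : \bar R).
  by apply/measurable_EFinP; exact: measurable_indic.
exists (push mu mf); split.
- rewrite /finite_moment.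
  rewrite (integral_push mu mf (measurable_fun_norm p (@measurable_id _ B setT)))//.
  apply: (@le_lt_trans _ _ (\int[mu]_y (`|a| ^+ p + `|b| ^+ p)%:E)); last first.
    by rewrite integral_cst1 ltry.
  apply: ge0_le_integral => //.
  + exact: measurable_fun_norm.
  + by move=> y _; rewrite lee_fin /f; case: ifP => _; rewrite ?lerDl ?lerDr exprn_ge0.
- rewrite (pushE mu mf) -[RHS](probability_setT mu); congr (mu _).
  by apply/seteqP; split => // y _; rewrite /= /f; case: ifP => _; [left|right].
- have -> : push mu mf [set b] = \int[mu]_y (\1_[set (b : B)] (f y))%:E.
    rewrite -(integral_push mu mf mind); last by move=> y; rewrite lee_fin indicE.
    by rewrite integral_indic// setIT.
  have mindf : measurable_fun setT (fun y => (\1_[set (b : B)] (f y))%:E : \bar R).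
    exact: (measurableT_comp mind mf).
  rewrite -ge0_integralZl_EFin//.
  have := @wcost_le_push R E hsep p _ _ mu _ _ (@measurable_id _ B setT) mf mu (push mu mf).
  move=> /(_ (fun _ _ => erefl) (fun _ _ => erefl)) h.
  apply: (le_trans (leeD2r _ h)); rewrite -ge0_integralD//; last 3 first.
  + by apply: measurable_fun_dist.
  + by move=> y _; rewrite mule_ge0// lee_fin indicE.
  + exact: emeasurable_funM.
  apply: ge0_le_integral => //.
  + by move=> y _; rewrite adde_ge0 ?cost_ge0// mule_ge0// lee_fin indicE.
  + apply: emeasurable_funD; [exact: measurable_fun_dist|exact: emeasurable_funM].
  + by apply/measurable_EFinP; exact: measurable_split.
  move=> y _; rewrite -EFinM -EFinD lee_fin indicE /f; case: ifPn => [ty|ty].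
    rewrite memNset; last by move/eqP; rewrite (negbTE ab).
    by rewrite mulr0 addr0 le_min lexx ltW.
  by rewrite mem_set// mulr1 le_min lexx andbT leNgt.
Qed.

Definition same_two_points_cost mu nu := forall (tau : probability B R) (a b : E),
  a != b -> finite_moment p tau -> tau [set a; b] = 1 ->
  wcost p mu tau = wcost p nu tau.

Lemma same_two_points_cost_sym mu nu : same_two_points_cost mu nu ->
  same_two_points_cost nu mu.
Proof. by move=> h tau a b ab ft tS; rewrite (h tau a b). Qed.

Lemma split_cost_eq mu nu a b s : same_two_points_cost mu nu -> a != b ->
  (0 <= s)%R -> split_cost mu a b s = split_cost nu a b s.
Proof.
wlog suff: mu nu / same_two_points_cost mu nu -> a != b -> (0 <= s)%R ->
    split_cost mu a b s <= split_cost nu a b s.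
  move=> h hc ab s0; apply/eqP; rewrite eq_le !h//.
  exact: same_two_points_cost_sym.
move=> hc ab s0; have [tau [ft tauS]] := split_cost_ge nu s0 ab.
by apply: le_trans; rewrite -(hc _ a b)//; exact: split_cost_le.
Qed.

(** Raising the surcharge from 0 to [s] raises the integrand of [split_cost] by exactly [s] on the
    first set, by at most [s] on the second, and not at all outside the second. The increase is the
    same for [mu] and [nu], and finiteness at surcharge 0 permits cancelling. *)
Lemma measure_gap_le mu nu a b (s : R) : finite_moment p mu ->
  same_two_points_cost mu nu -> a != b -> (0 < s)%R ->
  mu [set y : B | (`|(y : E) - b| ^+ p + s <= `|(y : E) - a| ^+ p)%R] <=
  nu [set y : B | (`|(y : E) - b| ^+ p < `|(y : E) - a| ^+ p)%R].
Proof.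
move=> hmu hc ab s0.
set A := (X in mu X <= _); set A' := (X in _ <= nu X).
have ma := measurable_distX a; have mb := measurable_distX b.
have mA : measurable A.
  rewrite -[A]setTI; apply: (measurable_fun_ler _ _ measurableT (Y := [set true])) => //.
  exact: measurable_funD.
have mA' : measurable A'.
  by rewrite -[A']setTI; exact: (measurable_fun_ltr _ _ measurableT (Y := [set true])).
have M0 : split_cost mu a b 0 \is a fin_num.
  rewrite ge0_fin_numE; last by apply: integral_ge0 => y _; rewrite lee_fin split_ge0.
  apply: le_lt_trans (moment_lty hsep a p0 hmu); apply: ge0_le_integral => //.
  - by apply/measurable_EFinP; exact: measurable_split.
  - exact: measurable_moment.
  - by move=> y _; rewrite lee_fin ge_min distrC lexx.
have int (la : probability B R) C : measurable C ->
    split_cost la a b 0 + s%:E * la C =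
    \int[la]_y ((Num.min (`|(y : E) - a| ^+ p) (`|(y : E) - b| ^+ p + 0))%:E +
      s%:E * (\1_C y)%:E).
  move=> mC; have mind : measurable_fun setT (fun z : B => (\1_C z)%:E : \bar R).
    by apply/measurable_EFinP; exact: measurable_indic.
  rewrite ge0_integralD//; last 3 first.
  - by apply/measurable_EFinP; exact: measurable_split.
  - by move=> y _; rewrite mule_ge0// lee_fin ?indicE// ltW.
  - exact: emeasurable_funM.
  by rewrite ge0_integralZl_EFin// ?integral_indic ?setIT ?ltW.
have mint C : measurable C -> measurable_fun setT (fun y : B =>
    (Num.min (`|(y : E) - a| ^+ p) (`|(y : E) - b| ^+ p + 0))%:E +
      s%:E * (\1_C y)%:E).
  move=> mC; apply: emeasurable_funD; first by apply/measurable_EFinP; exact: measurable_split.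
  by apply: emeasurable_funM => //; apply/measurable_EFinP; exact: measurable_indic.
have : split_cost mu a b 0 + s%:E * mu A <= split_cost nu a b 0 + s%:E * nu A'.
  apply: (@le_trans _ _ (split_cost mu a b s)).
    rewrite int//; apply: ge0_le_integral => //.
    - move=> y _; rewrite adde_ge0// ?lee_fin ?split_ge0// mulr_ge0 ?indicE// ltW//.
    - exact: mint.
    - by apply/measurable_EFinP; exact: measurable_split.
    move=> y _; rewrite -EFinM -EFinD lee_fin addr0 indicE.
    have [/set_mem|yA] := boolP (y \in A); rewrite /A/=.
      move=> h; rewrite mulr1 le_min; apply/andP; split.
        by apply: le_trans h; rewrite lerD2r ge_min lexx orbT.
      by rewrite lerD2r ge_min lexx orbT.
    rewrite mulr0 addr0 le_min ge_min lexx/= ge_min; apply/orP; right.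
    by rewrite lerDl ltW.
  rewrite (split_cost_eq hc ab (ltW s0)).
  rewrite int//; apply: ge0_le_integral => //.
  - by move=> y _; rewrite lee_fin split_ge0// ltW.
  - by apply/measurable_EFinP; exact: measurable_split.
  - exact: mint.
  move=> y _; rewrite -EFinM -EFinD lee_fin addr0 indicE.
  have [/set_mem|yA] := boolP (y \in A'); rewrite /A'/=.
    by move=> h; rewrite mulr1 (min_r (ltW h)) ge_min lexx orbT.
  have yab : (`|(y : E) - a| ^+ p <= `|(y : E) - b| ^+ p)%R.
    by rewrite leNgt; apply: contra yA => h; exact: mem_set.
  by rewrite mulr0 addr0 (min_l yab) ge_min lexx.
rewrite -(split_cost_eq hc)// leeD2lE// lee_pmul2l// lte_fin//.
Qed.

(** Let the gap [s] of [measure_gap_le] decrease to 0: the sets on the left increase to the strict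
    half-space. *)
Lemma closer_measure mu nu (a b : E) : finite_moment p mu -> finite_moment p nu ->
  same_two_points_cost mu nu ->
  mu [set y : B | (`|(y : E) - b| < `|(y : E) - a|)%R] =
  nu [set y : B | (`|(y : E) - b| < `|(y : E) - a|)%R].
Proof.
have [<-|ab] := eqVneq a b.
  move=> *; have -> : [set y : B | (`|(y : E) - a| < `|(y : E) - a|)%R] = set0.
    by apply/seteqP; split => // y /=; rewrite ltxx.
  by rewrite !measure0.
have -> : [set y : B | (`|(y : E) - b| < `|(y : E) - a|)%R] =
    [set y : B | (`|(y : E) - b| ^+ p < `|(y : E) - a| ^+ p)%R].
  by apply/seteqP; split => y /=; rewrite ltr_pXn2r// nnegrE.
wlog suff: mu nu / finite_moment p mu -> finite_moment p nu ->
    same_two_points_cost mu nu ->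
    mu [set y : B | (`|(y : E) - b| ^+ p < `|(y : E) - a| ^+ p)%R] <=
    nu [set y : B | (`|(y : E) - b| ^+ p < `|(y : E) - a| ^+ p)%R].
  move=> h hmu hnu hc; apply/eqP; rewrite eq_le !h//.
  exact: same_two_points_cost_sym.
move=> hmu hnu hc.
pose F n := [set y : B | (`|(y : E) - b| ^+ p + n.+1%:R^-1 <= `|(y : E) - a| ^+ p)%R].
have ma := measurable_distX a; have mb := measurable_distX b.
have mF n : measurable (F n).
  rewrite -[F n]setTI; apply: (measurable_fun_ler _ _ measurableT (Y := [set true])) => //.
  exact: measurable_funD.
have FE : [set y : B | (`|(y : E) - b| ^+ p < `|(y : E) - a| ^+ p)%R] = \bigcup_n F n.
  apply/seteqP; split => [y /= h|y [n _]]; last first.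
    by rewrite /F /=; apply: lt_le_trans; rewrite ltrDl invr_gt0.
  have [n /= hn] := @ltr_add_invr R _ _ h.
  by exists n => //=; exact: ltW.
have cvgF : mu (F n) @[n --> \oo] --> mu (\bigcup_n F n).
  apply: nondecreasing_cvg_mu => //; first exact: bigcupT_measurable.
  move=> n m nm; apply/subsetPset => y; rewrite /F /=; apply: le_trans.
  by rewrite lerD2l lef_pV2 ?posrE// ler_nat ltnS.
rewrite [X in mu X <= _]FE -(cvg_lim _ cvgF)//; apply: lime_le; first by apply/cvg_ex; eexists; exact: cvgF.
by apply: nearW => n; exact: measure_gap_le.
Qed.

End half_spaces.

(** * Half-space masses identify finitely supported measures *)

Section finite_support.
Context {R : realType} {E : normedModType R}.
Local Notation B := (@borelE R E).
Hypothesis hsep : @separable R E.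
Variable ip : E -> E -> R.
Hypothesis hip : inner_product ip.
Variables mu nu : probability B R.
Hypothesis closer : forall a b : E,
  mu [set y : B | `|(y : E) - b| < `|(y : E) - a|] =
  nu [set y : B | `|(y : E) - b| < `|(y : E) - a|].

Lemma measurable_half_space (u : E) (c : R) :
  measurable ([set y | c < ip u y] : set B).
Proof.
rewrite -[X in measurable X]setTI.
apply: (measurable_fun_ltr _ _ measurableT (Y := [set true])) => //.
exact: ip_measurable.
Qed.

Lemma half_space_measure (u : E) (c : R) :
  mu [set y : B | c < ip u y] = nu [set y : B | c < ip u y].
Proof.
have [->|u0] := eqVneq u 0.
  have [c0|c0] := ltP c 0.
    have -> : [set y : B | c < ip 0 y] = setT.
      by apply/seteqP; split => // y _ /=; rewrite (ip0l hip).
    by rewrite !probability_setT.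
  have -> : [set y : B | c < ip 0 y] = set0.
    by apply/seteqP; split => // y /=; rewrite (ip0l hip) ltNge c0.
  by rewrite !measure0.
have n0 : `|u| ^+ 2 != 0 by rewrite sqrf_eq0 normr_eq0.
(* Chosen so that the midpoint of [a] and [a + u] lies on the hyperplane [<u,y> = c]. *)
pose a := ((c / `|u| ^+ 2 - 2^-1) *: u).
have -> : [set y : B | c < ip u y] =
    [set y : B | `|(y : E) - (a + u)| < `|(y : E) - a|].
  apply/funext => y /=; apply/propext.
  rewrite -(@ltr_pXn2r _ 2%N _ `|y - (a + u)| `|y - a|) ?nnegrE//.
  rewrite !(normB2 hip) (normD2 hip) (ipDr hip) (ipC hip y u).
  have -> : ip a u = c - `|u| ^+ 2 / 2.
    by rewrite /a (ipZl hip) (ipxx hip) mulrBl -mulrA mulVf// mulr1 [2^-1 * _]mulrC.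
  move: (ip y a) (ip u y) (`|u| ^+ 2) (`|a| ^+ 2) (`|y| ^+ 2) => A B' C D F.
  by split => h; lra.
exact: closer.
Qed.

Lemma hyperplane_measure (u : E) (c : R) :
  mu [set y : B | ip u y = c] = nu [set y : B | ip u y = c].
Proof.
have m1 := measurable_half_space u c; have m2 := measurable_half_space (- u) (- c).
have dis : [set y : B | c < ip u y] `&` [set y : B | - c < ip (- u) y] = set0.
  apply/seteqP; split => // y [] /=; rewrite (ipNl hip); lra.
have -> : [set y : B | ip u y = c] =
    ~` ([set y : B | c < ip u y] `|` [set y : B | - c < ip (- u) y]).
  apply/seteqP; split => y /=.
    by move=> h [|]; rewrite ?(ipNl hip) h ltxx.
  move=> /not_orP[] /negP + /negP; rewrite -!leNgt (ipNl hip) => h1 h2.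
  by apply/eqP; rewrite eq_le h1/=; lra.
rewrite !probability_setC; [|exact: measurableU|exact: measurableU].
rewrite !measureU//; congr (_ - (_ + _))%E; exact: half_space_measure.
Qed.

Lemma measurable_hyperplanes (u : E) (s : seq R) :
  measurable ([set y | ip u y \in s] : set B).
Proof.
elim: s => [|c s ih].
  by rewrite (_ : [set _ | _] = set0)//; apply/seteqP; split.
rewrite (_ : [set _ | _] = [set y : B | ip u y == c] `|` [set y : B | ip u y \in s]).
  apply: measurableU => //; rewrite -[X in measurable X]setTI.
  apply: (measurable_fun_eqr _ _ measurableT (Y := [set true])) => //.
  exact: ip_measurable.
by apply/seteqP; split => y /=; rewrite inE; [move/orP|move=> h; apply/orP].
Qed.

(** Parallel hyperplanes are disjoint, so masses add; a repeated level contributes nothing, hence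
    the case distinction. *)
Lemma hyperplanes_measure (u : E) (s : seq R) :
  mu [set y : B | ip u y \in s] = nu [set y : B | ip u y \in s].
Proof.
elim: s => [|c s ih].
  rewrite (_ : [set _ | _] = set0); last by apply/seteqP; split.
  by rewrite !measure0.
have [cs|cs] := boolP (c \in s).
  rewrite (_ : [set y : B | ip u y \in c :: s] = [set y : B | ip u y \in s])//.
  apply/seteqP; split => y /=; rewrite inE; last by move=> ->; rewrite orbT.
  by move=> /orP[/eqP->|].
rewrite (_ : [set y : B | ip u y \in c :: s] =
    [set y : B | ip u y = c] `|` [set y : B | ip u y \in s]).
  have m1 : measurable [set y : B | ip u y = c].
    have := measurable_hyperplanes u [:: c].
    by rewrite (_ : [set y : B | ip u y \in [:: c]] = [set y : B | ip u y = c])//;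
      apply/seteqP; split => y /=; rewrite inE => /eqP.
  have m2 := measurable_hyperplanes u s.
  have dis : [set y : B | ip u y = c] `&` [set y : B | ip u y \in s] = set0.
    by apply/seteqP; split => // y [/= ->]; rewrite (negbTE cs).
  by rewrite !measureU//; congr (_ + _)%E; [exact: hyperplane_measure|exact: ih].
apply/seteqP; split => y /=; rewrite inE; first by move=> /orP[/eqP|]; [left|right].
by move=> [->|->]; rewrite ?eqxx ?orbT.
Qed.

Lemma dense_not_orthogonal (v : E) : v != 0 -> dense [set u | ip u v != 0].
Proof.
move=> v0 O [x Ox] oO; have [xv|] := eqVneq (ip x v) 0; last by exists x.
have /nbhs_ballP[e /= e0 eO] : nbhs x O by exact: open_nbhs_nbhs.
have nv : 0 < `|v| by rewrite normr_gt0.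
pose t := e / (2 * `|v|).
have t0 : 0 < t by rewrite divr_gt0// mulr_gt0.
exists (x + t *: v); split.
  apply: eO; rewrite -ball_normE /= opprD addNKr normrN normrZ gtr0_norm//.
  have -> : t * `|v| = e / 2 by rewrite /t; field; rewrite gt_eqF.
  lra.
rewrite /= (ipDl hip) (ipZl hip) xv add0r (ipxx hip).
by rewrite mulf_neq0 ?gt_eqF// exprn_gt0.
Qed.

Lemma open_not_orthogonal (v : E) : open [set u | ip u v != 0].
Proof.
have -> : [set u | ip u v != 0] = ip v @^-1` [set r | r != 0].
  by apply/seteqP; split => u /=; rewrite (ipC hip).
apply: open_comp; first by move=> x _; exact: ip_continuous.
exact: open_neq.
Qed.

(** Openness keeps density stable under intersection, and it later provides a generic vector inside
    a given dense sequence. *)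
Lemma generic_vectors (l : seq E) : {in l, forall v, v != 0} ->
  open [set u | {in l, forall v, ip u v != 0}] /\
  dense [set u | {in l, forall v, ip u v != 0}].
Proof.
elim: l => [|v l ih] l0.
  have -> : [set u | {in [::], forall v, ip u v != 0}] = setT.
    by apply/seteqP; split.
  by split; [exact: openT|move=> O O0 _; rewrite setIT].
have -> : [set u | {in v :: l, forall v, ip u v != 0}] =
  [set u | ip u v != 0] `&` [set u | {in l, forall v, ip u v != 0}].
  apply/seteqP; split => u /=.
    move=> h; split; first by apply: h; rewrite inE eqxx.
    by move=> w wl; apply: h; rewrite inE wl orbT.
  by move=> [h1 h2] w; rewrite inE => /orP[/eqP->//|]; exact: h2.
have [|o d] := ih; first by move=> w wl; apply: l0; rewrite inE wl orbT.
have v0 : v != 0 by apply: l0; rewrite inE eqxx.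
split; first by apply: openI => //; exact: open_not_orthogonal.
by apply: denseI => //; [exact: open_not_orthogonal|exact: dense_not_orthogonal].
Qed.

Lemma measurable_seq (s : seq E) : measurable ([set` s] : set B).
Proof.
elim: s => [|x s ih].
  by rewrite (_ : [set` _] = set0)//; apply/seteqP; split.
rewrite (_ : [set` _] = [set x] `|` [set` s]).
  by apply: measurableU => //; exact: borel_set1.
apply/seteqP; split => y /=; rewrite inE; first by move=> /orP[/eqP|]; [left|right].
by move=> [->|->]; rewrite ?eqxx ?orbT.
Qed.

(* Finitely many proper hyperplanes cannot contain a whole dense sequence, so testing countably many directions already forces [y] into the support. *)
Lemma finite_support_full (s : seq E) : mu [set` s] = 1%E -> nu [set` s] = 1%E.
Proof.
move=> mus; have ms := measurable_seq s.
have [x hx] := dense_sequence hsep.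
apply: ae_full => //.
have : {ae nu, forall (y : B) (n : nat), ip (x n) y \in map (ip (x n)) s}.
  apply: ae_foralln => n.
  apply: (full_ae (measurable_hyperplanes (x n) (map (ip (x n)) s))) => //.
  rewrite -hyperplanes_measure; apply: (full_sub ms) => //.
    exact: measurable_hyperplanes.
  by move=> y /= ys; exact: map_f.
apply: filterS => y /= hy; apply: contrapT => /negP ys.
pose l := [seq (y : E) - z | z <- s].
have l0 : {in l, forall v, v != 0}.
  by move=> _ /mapP[z zs ->]; rewrite subr_eq0; apply: contra ys => /eqP->.
have [ol dl] := generic_vectors l0.
have [u ul] : [set u | {in l, forall v, ip u v != 0}] !=set0.
  have [|u [_ ul]] := dl setT _ openT; [by exists 0|by exists u].
have /nbhs_ballP[e /= e0 eO] : nbhs u [set u | {in l, forall v, ip u v != 0}].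
  exact: open_nbhs_nbhs.
have [n un] := hx u e e0.
have /mapP[z zs] := hy n.
have /eO/(_ ((y : E) - z)) : ball u e (x n) by rewrite -ball_normE.
by rewrite (ipBr hip) => /(_ (map_f _ zs)) /eqP + h; rewrite h subrr.
Qed.

(** A vector [u] not orthogonal to any nonzero difference of points of [s] separates these points.
    On [s], every set [A] is therefore cut out by finitely many hyperplanes orthogonal to [u]. *)
Lemma finite_support_weq (s : seq E) : mu [set` s] = 1%E -> weq mu nu.
Proof.
move=> mus A mA; have nus := finite_support_full mus.
have ms := measurable_seq s.
pose l := [seq v <- [seq (x - z : E) | x <- s, z <- s] | v != 0].
have l0 : {in l, forall v, v != 0} by move=> v; rewrite mem_filter => /andP[].
have [_ dl] := generic_vectors l0.
have [u ul] : [set u | {in l, forall v, ip u v != 0}] !=set0.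
  have [|u [_ ul]] := dl setT _ openT; [by exists 0|by exists u].
pose H := [set y : B | ip u y \in map (ip u) [seq x <- s | `[< A x >]]].
have mH : measurable H by exact: measurable_hyperplanes.
have FH : [set` s] `&` A = [set` s] `&` H :> set B.
  apply/seteqP; split => y [/= ys].
    by move=> Ay; split => //; apply: map_f; rewrite mem_filter ys andbT; apply/asboolP.
  rewrite /H/= => /mapP[z]; rewrite mem_filter => /andP[/asboolP Az zs] yz.
  split => //; suff -> : y = z by [].
  apply/eqP; rewrite -subr_eq0; apply: contraT => yz0.
  have : y - z \in l by rewrite mem_filter yz0; apply: allpairs_f.
  by move=> /ul; rewrite (ipBr hip) yz subrr eqxx.
rewrite (full_setI ms mA mus) (full_setI ms mA nus) FH.
by rewrite -(full_setI ms mH mus) -(full_setI ms mH nus) hyperplanes_measure.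
Qed.

End finite_support.

(** * Density of finitely supported measures; separation of measures by small costs *)

Section approximation.
Context {R : realType} {E : normedModType R}.
Local Notation B := (@borelE R E).
Hypothesis hsep : @separable R E.
Variable p : nat.
Hypothesis p0 : (0 < p)%N.

(** A quantizer with finitely many values. The default 0 makes the cost of an uncovered [y] equal to
    [|y|^p], which is integrable. *)
Fixpoint last_hit (x : nat -> E) (e : R) (n : nat) (y : E) : E :=
  if n is m.+1 then if `|y - x m| < e then x m else last_hit x e m y else 0.

Lemma last_hit_mem x e n y : last_hit x e n y \in 0 :: [seq x i | i <- iota 0 n].
Proof.
elim: n => [|n ih]; first by rewrite inE.
rewrite -addn1 iotaD map_cat -cat_cons mem_cat addn1 /=.
by case: ifP => _; rewrite ?ih// add0n mem_seq1 eqxx orbT.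
Qed.

Lemma last_hit_near x e n m y : (m < n)%N -> `|y - x m| < e ->
  `|y - last_hit x e n y| < e.
Proof.
elim: n => // n ih; rewrite ltnS leq_eqVlt => /orP[/eqP-> h /=|mn h /=].
  by rewrite h.
by case: ifP => // _; exact: ih.
Qed.

Lemma last_hit_far x e n y : e <= `|y - last_hit x e n y| -> last_hit x e n y = 0.
Proof.
elim: n => //= n ih; case: ifPn => [h|_]; last exact: ih.
by move/(lt_le_trans h); rewrite ltxx.
Qed.

Lemma measurable_last_hit x e n : measurable_fun setT (last_hit x e n : B -> B).
Proof.
elim: n => [|n ih]; first exact: measurable_cst.
apply: measurable_fun_ifT => //.
by apply: measurable_fun_ltr => //; exact: borel_dist.
Qed.

Local Open Scope ereal_scope.

Lemma finite_support_dense (mu : probability B R) (d : R) :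
  finite_moment p mu -> (0 < d)%R ->
  exists (la : probability B R) (s : seq E),
    [/\ finite_moment p la, la [set` s] = 1 & wcost p mu la < d%:E].
Proof.
move=> hmu d0; have [x hx] := dense_sequence hsep.
(* The cap at 1 gives [e ^+ p <= e], so covered points cost at most [d / 2]; the other half is left
   for the tail. *)
pose e := Num.min 1%R (d / 2)%R.
have e0 : (0 < e)%R by rewrite lt_min ltr01 divr_gt0.
have e0' := ltW e0; have e1 : (e <= 1)%R by rewrite ge_min lexx.
have ed : (e ^+ p <= d / 2)%R.
  apply: (@le_trans _ _ e); last by rewrite ge_min lexx orbT.
  by rewrite -[leRHS]expr1 ler_wiXn2l// ltW.
have mh n := measurable_last_hit x e n.
have mN : measurable_fun setT (fun y : B => (`|(y : E)| ^+ p)%:E).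
  exact: measurable_fun_norm (@measurable_id _ B setT).
(* The cost of the points still uncovered at stage [n]: eventually 0 at each [y] and dominated by
   [|y|^p], so its integral tends to 0. *)
pose h n (y : B) : \bar R :=
  if (`|(y : E) - last_hit x e n y| < e)%R then 0 else (`|(y : E)| ^+ p)%:E.
have mdist n : measurable_fun setT (fun y : B => `|(y : E) - (last_hit x e n y : E)|%R).
  exact: (measurableT_comp (measurable_dist hsep)
    (measurable_fun_pair (@measurable_id _ B setT) (mh n))).
have mhn n : measurable_fun setT (h n).
  by apply: measurable_fun_ifT => //; exact: measurable_fun_ltr.
have h0 n y : 0 <= h n y by rewrite /h; case: ifP.
have hcv : {ae mu, forall y, setT y -> h ^~ y @ \oo --> cst 0 y}.
  apply: aeW => y _; have [m ym] := hx y e e0; apply: cvg_near_cst.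
  exists m.+1 => // n /= mn; rewrite /h; case: ifPn => // /negP; case.
  exact: last_hit_near ym.
have ig : mu.-integrable setT (fun y : B => (`|(y : E)| ^+ p)%:E).
  apply/integrableP; split => //.
  by under eq_integral do rewrite gee0_abs ?cost_ge0//.
have hg : {ae mu, forall (y : B) n, setT y -> `|h n y| <= (`|(y : E)| ^+ p)%:E}.
  apply: aeW => y n _; rewrite gee0_abs// /h; case: ifP => // _; exact: cost_ge0.
have [_ _] := dominated_convergence measurableT mhn (measurable_cst _) hcv ig hg.
rewrite integral0 => cv.
have [n hn] : exists n, \int[mu]_y h n y < (d / 2)%:E.
  have : nbhs (0 : \bar R) [set z | z < (d / 2)%:E].
    by apply: (@nbhs_open_ereal_lt _ 0%R (fun=> d / 2)%R); rewrite divr_gt0.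
  by move=> /cv [n _ hn]; exists n; exact: (hn n (leqnn n)).
have mg := measurable_last_hit x e n.
exists (push mu mg), (0%R :: [seq x i | i <- iota 0 n]); split.
- rewrite /finite_moment (integral_push mu mg mN)//.
  apply: (@le_lt_trans _ _ (\int[mu]_y ((2 ^+ p.-1)%:E * ((`|(y : E)| ^+ p)%:E + (e ^+ p)%:E)))).
    apply: ge0_le_integral => //.
    + exact: measurable_fun_norm.
    + by apply: emeasurable_funM => //; exact: emeasurable_funD.
    move=> y _; rewrite -EFinD -EFinM lee_fin -(prednK p0).
    apply: le_trans (exprD_le _ _ (ltW e0)) => //.
    rewrite lerXn2r ?nnegrE ?addr_ge0//.
    have [h1|h1] := ltP `|(y : E) - last_hit x e n y|%R e.
      rewrite -[last_hit x e n y](subKr (y : E)).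
      by rewrite (le_trans (ler_normB _ _))// lerD2l ltW.
    by rewrite (last_hit_far h1) normr0 addr_ge0// ltW.
  rewrite ge0_integralZl_EFin//; last 2 first.
  + by move=> y _; rewrite adde_ge0// ?cost_ge0// lee_fin exprn_ge0// ltW.
  + exact: emeasurable_funD.
  rewrite ge0_integralD//; last by move=> y _; rewrite lee_fin exprn_ge0// ltW.
  rewrite integral_cst1; apply: lte_mul_pinfty => //.
  by rewrite lte_add_pinfty// ltry.
- rewrite (pushE mu mg) -[RHS](probability_setT mu); congr (mu _).
  by apply/seteqP; split => // y _; exact: last_hit_mem.
- have := @wcost_le_push R E hsep p _ _ mu _ _ (@measurable_id _ B setT) mg mu (push mu mg).
  move=> /(_ (fun _ _ => erefl) (fun _ _ => erefl)) /le_lt_trans; apply.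
  apply: (@le_lt_trans _ _ (\int[mu]_y ((e ^+ p)%:E + h n y))).
    apply: ge0_le_integral => //.
    + exact: measurable_fun_dist.
    + exact: emeasurable_funD.
    move=> y _; rewrite /h; case: ifPn => [h1|].
      by rewrite adde0 lee_fin lerXn2r ?nnegrE// ltW.
    rewrite -leNgt => /last_hit_far ->; rewrite subr0 -EFinD lee_fin lerDr.
    by rewrite exprn_ge0// ltW.
  rewrite ge0_integralD//; last by move=> y _; rewrite lee_fin exprn_ge0// ltW.
  rewrite integral_cst1 [in ltRHS](splitr d) EFinD; apply: lee_ltD => //.
Qed.

Definition thicken (C : set B) (r : R) : set B :=
  [set y : B | exists2 x : E, C x & (`|x - (y : E)| < r)%R].

Lemma measurable_thicken C r : measurable (thicken C r).
Proof.
apply: borel_open.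
have -> : thicken C r = \bigcup_(x in (C : set E)) ball x r.
  by rewrite -ball_normE; apply/seteqP; split => y [x Cx xy]; exists x.
by apply: bigcup_open => x _; exact: ball_open.
Qed.

Lemma coupling_markov (mu nu : probability B R) pi (r : R) : coupling mu nu pi ->
  (0 < r)%R ->
  (r ^+ p)%:E * pi [set z : B * B | (r <= `|(z.1 : E) - (z.2 : E)|)%R] <=
  \int[pi]_z (`|(z.1 : E) - (z.2 : E)| ^+ p)%:E.
Proof.
move=> hpi r0; set D := [set z | _].
have mD : measurable D.
  rewrite -[D]setTI; apply: (measurable_fun_ler _ _ measurableT (Y := [set true])) => //.
  exact: measurable_dist.
have mind : measurable_fun setT (fun z : B * B => (\1_D z)%:E : \bar R).
  by apply/measurable_EFinP; exact: measurable_indic.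
have <- : \int[pi]_z (\1_D z)%:E = pi D by rewrite integral_indic// setIT.
have rp : (0 <= r ^+ p)%R by rewrite exprn_ge0// ltW.
rewrite -ge0_integralZl_EFin//.
apply: ge0_le_integral => //.
- by move=> z _; rewrite -EFinM lee_fin mulr_ge0.
- exact: emeasurable_funM.
- exact: measurable_cost.
move=> z _; rewrite -EFinM lee_fin indicE.
have [/set_mem h|_] := boolP (z \in D); last by rewrite mulr0 exprn_ge0.
by rewrite mulr1 lerXn2r ?nnegrE// ltW.
Qed.

(** A Prokhorov-type bound: mass starting in [C] either moves by less than [r] or belongs to the far
    pairs, which Markov's inequality bounds by [c / r^p]. Some coupling costs less than [c], so no
    optimal one is required. *)
Lemma wcost_lt_thicken (mu nu : probability B R) (c r : R) (C : set B) :
  (0 < r)%R -> measurable C -> wcost p mu nu < c%:E ->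
  mu C <= nu (thicken C r) + (c / r ^+ p)%:E.
Proof.
move=> r0 mC /ereal_inf_lt[_ [pi [hpi ->]] ltc].
set D := [set z : B * B | (r <= `|(z.1 : E) - (z.2 : E)|)%R].
have mD : measurable D.
  rewrite -[D]setTI; apply: (measurable_fun_ler _ _ measurableT (Y := [set true])) => //.
  exact: measurable_dist.
have mT := measurable_thicken C r.
have mU : measurable (setT `*` thicken C r : set (B * B)) by exact: measurableX.
rewrite -(hpi C mC).1 -(hpi _ mT).2.
apply: (@le_trans _ _ (pi ((setT `*` thicken C r) `|` D))).
  apply: le_measure; rewrite ?inE.
  - exact: measurableX.
  - exact: measurableU.
  move=> [y z] /= [Cy _]; have [yz|yz] := ltP `|(y : E) - (z : E)|%R r; last by right.
  by left; split => //; exists y.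
apply: le_trans (measureU2 _ mU mD) _; rewrite leeD2l//.
have rp : (0 < r ^+ p)%R by rewrite exprn_gt0.
rewrite -(@lee_pmul2l _ (r ^+ p)%:E)// -EFinM mulrCA mulfV ?gt_eqF// mulr1.
exact: le_trans (coupling_markov hpi r0) (ltW ltc).
Qed.

(** Passing through [la] at the level of sets, with two thickenings by [r], replaces the triangle
    inequality for costs and the gluing of couplings behind it. *)
Lemma close_le (mu nu : probability B R) (C : set E) :
  (forall c : R, (0 < c)%R -> exists2 la : probability B R,
    wcost p mu la < c%:E & wcost p la nu < c%:E) ->
  closed C -> mu C <= nu C.
Proof.
move=> h cC; have mC : measurable (C : set B) by exact: borel_closed.
pose F n := thicken C (2 * n.+1%:R^-1).
have muF n : mu C <= nu (F n).
  pose r : R := (n.+1%:R^-1)%R; have r0 : (0 < r)%R by rewrite invr_gt0.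
  have rp : (0 < r ^+ p)%R by rewrite exprn_gt0.
  apply/lee_addgt0Pr => e e0.
  (* With this bound each of the two Markov errors is [e / 2]. *)
  have [|la l1 l2] := h (e / 2 * r ^+ p)%R; first by rewrite mulr_gt0// divr_gt0.
  apply: le_trans (wcost_lt_thicken r0 mC l1) _.
  rewrite mulfK ?gt_eqF//.
  have := wcost_lt_thicken r0 (measurable_thicken C r) l2.
  rewrite mulfK ?gt_eqF// => /(leeD2r (e / 2)%:E) /le_trans; apply.
  rewrite -addeA -EFinD -splitr leeD2r//; apply: le_measure; rewrite ?inE.
  - exact: measurable_thicken.
  - exact: measurable_thicken.
  move=> y [z [x Cx xz] zy]; exists x => //.
  by apply: le_lt_trans (ler_distD z x y) _; rewrite mulr2n mulrDl mul1r ltrD.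
have FC : \bigcap_n F n = C.
  apply/seteqP; split => [y yF|y Cy n _]; last first.
    by exists y => //; rewrite subrr normr0 mulr_gt0.
  rewrite (closure_id C).1//; move=> /= U /nbhs_ballP[e /= e0 eU].
  have e20 : (0 < e / 2)%R by rewrite divr_gt0.
  have [n] := @ltr_add_invr R 0%R (e / 2)%R e20; rewrite add0r => hn.
  have [x Cx xy] := yF n I; exists x; split => //; apply: eU.
  rewrite -ball_normE /= distrC; apply: lt_trans xy _.
  by rewrite mulrC -ltr_pdivlMr.
have cvgF : nu (F n) @[n --> \oo] --> nu C.
  rewrite -FC; apply: nonincreasing_cvg_mu => //.
  - by rewrite ltey_eq fin_num_measure//; exact: measurable_thicken.
  - by move=> n; exact: measurable_thicken.
  - by apply: bigcap_measurable => // n _; exact: measurable_thicken.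
  - move=> m n mn; apply/subsetPset => y [x Cx xy]; exists x => //.
    apply: lt_le_trans xy _; rewrite ler_pM2l// lef_pV2 ?posrE// ler_nat ltnS//.
rewrite -(cvg_lim _ cvgF)//; apply: lime_ge; first by apply/cvg_ex; eexists; exact: cvgF.
by apply: nearW => n; exact: muF.
Qed.

Lemma close_weq (mu nu : probability B R) :
  (forall c : R, (0 < c)%R -> exists2 la : probability B R,
    wcost p mu la < c%:E & wcost p nu la < c%:E) -> weq mu nu.
Proof.
move=> h A mA.
apply: (measure_unique (@open E : set (set B)) (fun=> setT)) => //.
- by move=> ? ?; exact: openI.
- by move=> _; exact: openT.
- by rewrite bigcup_const.
- move=> U oU; have cU : closed (~` U) by exact: open_closedC.
  have mU : measurable (U : set B) by exact: borel_open.
  have : mu (~` U) = nu (~` U).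
    apply/eqP; rewrite eq_le !close_le// => c c0; have [la l1 l2] := h c c0;
      exists la => //; rewrite wcost_sym//.
  have EC (la : probability B R) : la U = 1 - la (~` U).
    by rewrite -probability_setC ?setCK//; exact: measurableC.
  move=> hC; transitivity (1 - mu (~` U)); first exact: EC.
  by transitivity (1 - nu (~` U)); [congr (_ - _); exact: hC|exact/esym/EC].
- by move=> _; exact: (le_lt_trans (probability_le1 mu measurableT) (ltry _)).
Qed.

End approximation.

(** * Isometries of the Wasserstein space and of [E] *)

Section isometries.
Context {R : realType} {E : normedModType R}.
Local Notation B := (@borelE R E).
Hypothesis hsep : @separable R E.
Variable ip : E -> E -> R.
Hypothesis hip : inner_product ip.
Variable k : nat.
Local Notation p := (k.+2.*2).
Local Notation W := (@Wp R E p).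
Implicit Types (mu nu tau : W) (Phi : W -> W).
Local Open Scope ereal_scope.

Let p0 : (0 < p)%N. Proof. by []. Qed.

Definition wisometry Phi := forall mu nu,
  wcost p (sval (Phi mu)) (sval (Phi nu)) = wcost p (sval mu) (sval nu).

Lemma finite_moment_dirac (a : E) : finite_moment p (\d_(a : B) : probability B R).
Proof.
rewrite /finite_moment integral_dirac//.
  by rewrite diracT mul1e ltry.
exact: measurable_fun_norm (@measurable_id _ B setT).
Qed.

Definition wdirac (a : E) : W := exist _ _ (finite_moment_dirac a).

Lemma wdirac1 a : sval (wdirac a) [set a] = 1.
Proof. by rewrite /= diracE mem_set. Qed.

Lemma wcost_dirac2 (mu nu : probability B R) (a b : E) :
  mu [set a] = 1 -> nu [set b] = 1 -> wcost p mu nu = (`|a - b| ^+ p)%:E.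
Proof.
move=> mua nub; rewrite (wcost_dirac hsep p nu mua) /moment.
have mb := @borel_set1 R E b.
rewrite (@eq_integral_full _ _ _ nu _ _ (cst (`|a - b| ^+ p)%:E) mb nub)//.
- exact: integral_cst1.
- exact: measurable_moment.
- by move=> y ->.
Qed.

(** Surjectivity supplies [nu] with image the Dirac mass at 0. The doubling of the segment from [mu]
    beyond [nu] is carried to one beyond that Dirac mass, where [extension_dirac] applies. *)
Lemma wisometry_dirac Phi mu (a : E) : wisometry Phi ->
  (forall nu, exists nu', Phi nu' = nu) -> sval mu [set a] = 1 ->
  exists b : E, sval (Phi mu) [set b] = 1.
Proof.
move=> iso surj mua; have [nu nu0] := surj (wdirac 0%R).
have [eta [feta le1 le2]] := dirac_extension hsep p0 mua (svalP nu).
pose heta : W := exist _ eta feta.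
apply: (@extension_dirac R E hsep p ip k.+1 _ (sval (Phi heta)) (sval (Phi nu))) => //.
- by rewrite nu0 wdirac1.
- exact: svalP.
- exact: svalP.
- by rewrite !iso.
- by rewrite !iso.
Qed.

Lemma wisometry_fixing_diracs Phi mu : wisometry Phi ->
  (forall nu (a : E), sval nu [set a] = 1 -> sval (Phi nu) [set a] = 1) ->
  weq (sval mu) (sval (Phi mu)).
Proof.
move=> iso fixd.
have mom nu a : moment p (sval nu) a = moment p (sval (Phi nu)) a.
  have d1 := wdirac1 a.
  rewrite -(wcost_dirac hsep p _ d1) -iso.
  by rewrite (wcost_dirac hsep p _ (fixd _ _ d1)).
have two tau (a b : E) : a != b -> sval tau [set a; b] = 1 ->
    weq (sval tau) (sval (Phi tau)).
  move=> ab tS; apply: (two_points_weq hip hsep _ _ (mom tau) ab tS); exact: svalP.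
have same nu : same_two_points_cost p (sval nu) (sval (Phi nu)).
  move=> tau a b ab ft tS; pose htau : W := exist _ tau ft.
  rewrite -[LHS](iso nu htau); apply: weq_wcost => // A mA.
  exact/esym/(two htau a b ab tS).
have fin nu (s : seq E) : sval nu [set` s] = 1 -> weq (sval nu) (sval (Phi nu)).
  apply: (finite_support_weq hsep hip) => a b.
  by apply: (closer_measure hsep p0) => //; exact: svalP.
(* The intermediate measure [la] is finitely supported, hence fixed by [Phi]: being close to [mu],
   it is equally close to [Phi mu]. *)
apply: (@close_weq R E hsep p) => c c0.
have [la [s [fla las lt]]] := finite_support_dense hsep p0 (svalP mu) c0.
exists la => //; pose hla : W := exist _ la fla.
rewrite (@weq_wcost R E p _ la (sval (Phi mu)) (sval (Phi hla)))//.
  by rewrite iso.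
exact: (fin hla s las).
Qed.

Lemma wcost_push_isometry (f : E -> E) (mf : measurable_fun setT (f : B -> B))
    (mu nu : probability B R) : (forall x y, `|f x - f y| = `|x - y|)%R ->
  wcost p (push mu mf) (push nu mf) <= wcost p mu nu.
Proof.
move=> isof; apply: wcost_ge => pi hpi.
have mf1 := measurableT_comp mf (@measurable_fst _ _ B B).
have mf2 := measurableT_comp mf (@measurable_snd _ _ B B).
have := @wcost_le_push R E hsep p _ _ pi _ _ mf1 mf2 (push mu mf) (push nu mf).
have mpre (A : set B) : measurable A -> measurable (f @^-1` A : set B).
  by move=> mA; rewrite -[X in measurable X]setTI; exact: mf.
move=> /(_ _ _)/le_trans; apply.
- by move=> A mA; exact: (coupling_fst hpi (mpre A mA)).
- by move=> A mA; exact: (coupling_snd hpi (mpre A mA)).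
by under eq_integral do rewrite isof.
Qed.

Lemma isometry_continuous (f : E -> E) :
  (forall x y, `|f x - f y| = `|x - y|)%R -> continuous f.
Proof.
move=> isof x; apply/cvgrPdist_lt => e e0; near=> y.
by rewrite isof; near: y; exact: cvgr_dist_lt.
Unshelve. all: by end_near. Qed.

(** By polarization [f] preserves inner products of differences based at [y]; expanding the squared
    norm of the defect then gives 0, without surjectivity of [f]. *)
Lemma isometry_affine (f : E -> E) (t : R) (x y : E) :
  (forall x y, `|f x - f y| = `|x - y|)%R ->
  (f (t *: x + (1 - t) *: y) = t *: f x + (1 - t) *: f y)%R.
Proof.
move=> isof.
have ipf a b : (ip (f a - f y) (f b - f y) = ip (a - y) (b - y))%R.
  have := isof a b; have -> : (f a - f b = (f a - f y) - (f b - f y))%R.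
    by rewrite opprB addrA subrK.
  have -> : (a - b = (a - y) - (b - y))%R by rewrite opprB addrA subrK.
  move=> /(congr1 (fun r => r ^+ 2)%R).
  by rewrite (normB2 hip (f a - f y)%R) (normB2 hip (a - y)%R) !isof; lra.
pose z := (t *: x + (1 - t) *: y)%R.
have zy : (z - y = t *: (x - y))%R.
  by rewrite /z scalerBl scale1r scalerBr [(y - _)%R]addrC addrA addrK.
have fE : (t *: f x + (1 - t) *: f y = t *: (f x - f y) + f y)%R.
  by rewrite scalerBl scale1r scalerBr addrA addrAC.
rewrite fE -/z; apply/eqP; rewrite -subr_eq -subr_eq0 -normr_eq0 -sqrf_eq0.
rewrite (normB2 hip (f z - f y)%R) normrZ exprMn (ipZr hip).
rewrite -(ipxx hip (f z - f y)%R) -(ipxx hip (f x - f y)%R) !ipf zy.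
rewrite !(ipZl hip) !(ipZr hip) -normrX ger0_norm ?sqr_ge0//.
apply/eqP; ring.
Qed.

End isometries.

(** * Reduction to an isometry that fixes all Dirac masses *)

Theorem theorem3p18 (R : realType) (E : completeNormedModType R)
  (ip : E -> E -> R) (hip : inner_product ip) (hsep : @separable R E)
  (p : nat) (hp4 : (4 <= p)%N) (hpeven : ~~ odd p)
  (Phi : @Wp R E p -> @Wp R E p) (hPhi_bij : bijective Phi)
  (hPhi_iso : forall mu nu : @Wp R E p,
     wdist p (sval (Phi mu)) (sval (Phi nu)) = wdist p (sval mu) (sval nu)) :
  exists psi : E -> E,
    [/\ bijective psi,
        (forall x y : E, `|psi x - psi y| = `|x - y|),
        (forall (t : R) (x y : E),
           psi (t *: x + (1 - t) *: y) = t *: psi x + (1 - t) *: psi y) &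
        (forall (mu : @Wp R E p) (A : set (@borelE R E)), measurable A ->
           sval (Phi mu) A = sval mu (psi @^-1` A))].
Proof.
have [k pk] : exists k, p = k.+2.*2.
  have := odd_double_half p; rewrite (negbTE hpeven) add0n => hp.
  move: hp4; rewrite -hp (leq_double 2) => /subnK h.
  by exists (p./2 - 2)%N; rewrite -addn2 h.
move: Phi hPhi_bij hPhi_iso; rewrite {}pk => {p hp4 hpeven} Phi [Psi PhiK PsiK] hdist.
have iso : wisometry Phi.
  by move=> mu nu; apply: (wdist_wcost hsep); [|exact: svalP..|exact: hdist].
have isoV : wisometry Psi by move=> mu nu; rewrite -iso !PsiK.
have dirac mu a := @wisometry_dirac R E hsep ip hip k Phi mu a iso (fun nu => ex_intro _ (Psi nu) (PsiK nu)).
have diracV mu a := @wisometry_dirac R E hsep ip hip k Psi mu a isoV (fun nu => ex_intro _ (Phi nu) (PhiK nu)).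
have dist_inj (x y x' y' : E) :
    ((`|x - y| ^+ k.+2.*2)%:E = (`|x' - y'| ^+ k.+2.*2)%:E :> \bar R) -> `|x - y| = `|x' - y'|.
  by move=> [] h; apply: (@pexpIrn _ k.+2.*2); rewrite ?nnegrE.
have /choice[psi hpsi] : forall x : E, exists y : E, sval (Phi (wdirac k x)) [set y] = 1%E.
  by move=> x; exact: dirac (wdirac1 k x).
have isop x y : `|psi x - psi y| = `|x - y|.
  apply: dist_inj; rewrite -(wcost_dirac2 hsep k (hpsi x) (hpsi y)) iso.
  exact: (wcost_dirac2 hsep k (wdirac1 k x) (wdirac1 k y)).
have eq_dist (x y : E) : `|x - y| = 0 -> x = y.
  by move/eqP; rewrite normr_eq0 subr_eq0 => /eqP.
have fixd (mu : @Wp R E k.+2.*2) (x : E) : sval mu [set x] = 1%E -> sval (Phi mu) [set psi x] = 1%E.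
  move=> mux; have [b hb] := dirac _ _ mux; suff <- : b = psi x by [].
  apply: eq_dist; rewrite -(normr0 E) -(subrr x); apply: dist_inj.
  rewrite -(wcost_dirac2 hsep k hb (hpsi x)) iso.
  exact: (wcost_dirac2 hsep k mux (wdirac1 k x)).
(* Surjectivity of [psi]: the inverse [Psi] also preserves Dirac masses, so the preimage of the one
   at [y] sits at some [x]. *)
have /choice[phi hphi] : forall y : E, exists x : E, psi x = y.
  move=> y; have [x hx] := diracV _ _ (wdirac1 k y); exists x.
  have := fixd _ _ hx; rewrite PsiK /= diracE.
  have [/set_mem ->//|_ /eqP] := boolP (y \in [set psi x]).
  by rewrite eqe eq_sym oner_eq0.
have isoq x y : `|phi x - phi y| = `|x - y| by rewrite -isop !hphi.
have psiK : cancel psi phi.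
  by move=> x; apply: eq_dist; rewrite -isop hphi subrr normr0.
have mphi : measurable_fun setT (phi : @borelE R E -> @borelE R E).
  by apply: borel_fun; exact: isometry_continuous.
have mpsi : measurable_fun setT (psi : @borelE R E -> @borelE R E).
  by apply: borel_fun; exact: isometry_continuous.
have fm mu : finite_moment k.+2.*2 (push (sval (Phi mu)) mphi).
  rewrite /finite_moment (integral_push _ mphi); last 2 first.
  - exact: measurable_fun_norm (@measurable_id _ _ setT).
  - by move=> y; exact: cost_ge0.
  (* [|phi y| = |phi y - phi (psi 0)| = |y - psi 0|], so the moment to bound is the potential of
     [Phi mu] at [psi 0]. *)
  apply: le_lt_trans (moment_lty hsep (psi 0) _ (svalP (Phi mu))) => //.
  rewrite le_eqVlt; apply/orP; left; apply/eqP; apply: eq_integral => y _.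
  by rewrite -[phi y]subr0 -{1}(psiK 0) isoq distrC.
pose Phi' mu : @Wp R E k.+2.*2 := exist _ _ (fm mu).
have iso' : wisometry Phi'.
  move=> mu nu; apply/eqP; rewrite eq_le.
  rewrite -(iso mu nu) (wcost_push_isometry hsep k mphi)//=.
  (* Pushing by an isometry of [E] was only shown not to increase costs; pushing back by [psi] gives
     the reverse inequality. *)
  have back la : weq la (push (push la mphi) mpsi).
    move=> A mA; rewrite (pushE _ mpsi) (pushE la mphi); congr (la _).
    by apply/seteqP; split => y /=; rewrite hphi.
  rewrite (weq_wcost _ (back (sval (Phi mu))) (back (sval (Phi nu)))).
  exact: wcost_push_isometry.
exists psi; split => //.
- by exists phi.
- by move=> t x y; exact: (isometry_affine hip).
move=> mu A mA.
have mA' : measurable (psi @^-1` A : set (@borelE R E)).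
  by rewrite -[X in measurable X]setTI; exact: mpsi.
rewrite (@wisometry_fixing_diracs R E hsep ip hip k Phi' mu iso' _ _ mA')/=.
  rewrite (pushE _ mphi); congr (sval (Phi mu) _).
  by apply/seteqP; split => y /=; rewrite hphi.
move=> nu x nux; rewrite /= (pushE _ mphi).
rewrite (_ : phi @^-1` [set x] = [set psi x]); first exact: fixd.
by apply/seteqP; split => y /=; [move=> <-; rewrite hphi|move=> ->; rewrite psiK].
Qed.
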